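(* Let $p\in(\frac73,\frac83)$, let $\gamma_0\in\mathcal H:=W^{\frac32p-2,2}(\mathbb R/\mathbb Z,\mathbb R^n)$ be injective on $[0,1)$ with $|\gamma_0'|>0$ on $\mathbb R/\mathbb Z$, and let $t\mapsto\gamma(\cdot,t)\in C^1([0,\infty),\mathcal H)$ be the unique solution of $\frac{\partial}{\partial t}\gamma(\cdot,t)=-\nabla_\Sigma\,\mathrm{intM}^{(p,2)}(\gamma(\cdot,t))$ for all $t>0$, $\gamma(\cdot,0)=\gamma_0$. Then $\gamma(\cdot,t)$ is injective on $[0,1)$ for all $t\ge0$. If the initial embedding $\gamma_0$ represents the tame knot class $\mathcal K$, i.e. $[\gamma_0]=\mathcal K$, then $[\gamma(\cdot,t)]=\mathcal K$ for all $t>0$.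
   Context: Sobolev–Slobodeckij spaces: for $s\in(0,1)$ and $f\in L^2(\mathbb R/\mathbb Z,\mathbb R^m)$ put $[f]_{s,2}^2:=\int_{\mathbb R/\mathbb Z}\int_{-1/2}^{1/2}|f(u+w)-f(u)|^2|w|^{-1-2s}\,dw\,du$; for $k\in\{0,1\}$, $W^{k+s,2}(\mathbb R/\mathbb Z,\mathbb R^m)$ is the Hilbert space of $1$-periodic $f\in W^{k,2}$ with $\|f\|_{W^{k+s,2}}^2:=\|f\|_{W^{k,2}}^2+[f^{(k)}]_{s,2}^2<\infty$, with the inner product inducing this norm. For $p\in(\frac73,\frac83)$ the space $\mathcal H$ embeds into $C^1$. $W^{\frac32p-2,2}_{\mathrm{ir}}(\mathbb R/\mathbb Z,\mathbb R^n)$ is the open subset of $\mathcal H$ of curves injective on $[0,1)$ with $|\gamma'|>0$ everywhere. Energy: $\mathrm{intM}^{(p,2)}(\gamma):=\iiint_{(\mathbb R/\mathbb Z)^3}\frac{|\gamma'(u_1)||\gamma'(u_2)||\gamma'(u_3)|}{R^{(p,2)}(\gamma(u_1),\gamma(u_2),\gamma(u_3))}\,du_1du_2du_3$ with $R^{(p,2)}(x,y,z):=\frac{(|z-x||y-x||z-y|)^p}{|(z-x)\wedge(y-x)|^2}$. It is continuously Fréchet differentiable on $W^{\frac32p-2,2}_{\mathrm{ir}}$; $\nabla$ denotes the gradient with respect to the inner product of $\mathcal H$. Constraint and projected gradient: $\Sigma(\gamma):=\log|\gamma'|\in W^{\frac32p-3,2}(\mathbb R/\mathbb Z)$, with differential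 $D\Sigma(\gamma)h=\langle\gamma',h'\rangle/|\gamma'|^2$; $\nabla_\Sigma\mathcal E(\gamma):=\Pi_{\mathcal N(D\Sigma(\gamma))}\nabla\mathcal E(\gamma)$, where $\Pi$ is the $\mathcal H$-orthogonal projection onto the null space of $D\Sigma(\gamma)$. The flow has a unique global solution for every such $\gamma_0$. Knot class: $[\gamma]$ denotes the knot class (ambient isotopy class in $\mathbb R^n$) of the embedded closed curve $\gamma$; regular embedded $C^1$ closed curves represent tame knot classes. *)

(* Defs.v *)
From HB Require Import structures.
From mathcomp Require Import all_boot all_order all_algebra.
From mathcomp Require Import all_classical all_reals all_analysis.
From mathcomp Require Import measurable_realfun ring lra.

Set Implicit Arguments.
Unset Strict Implicit.
Unset Printing Implicit Defensive.

Import Order.TTheory GRing.Theory Num.Theory.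
Import numFieldNormedType.Exports.

Local Open Scope ring_scope.
Local Open Scope classical_set_scope.

(* 'rV[R]_n carries the sup norm in the library (which has the right topology),
   hence the explicit Euclidean structure. *)
Section euclidean.
Context {R : realType} {n : nat}.
Implicit Types x y z : 'rV[R]_n.

Definition dot x y : R := \sum_i x 0 i * y 0 i.

Definition enorm x : R := Num.sqrt (dot x x).

(* Euclidean norm of x ^ y in the second exterior power, i.e. in the
   orthonormal basis (e_i ^ e_j)_(i < j). *)
Definition wedge_norm x y : R :=
  Num.sqrt (\sum_(i < n) \sum_(j < n | (i < j)%N) (x 0 i * y 0 j - x 0 j * y 0 i) ^+ 2).

End euclidean.

Section periodic_functions.
Context {R : realType} {n : nat}.
Implicit Types f g : R -> 'rV[R]_n.
Notation mu := (@lebesgue_measure R).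

Definition periodic1 (T : Type) (f : R -> T) := forall x, f (x + 1) = f x.

Definition L2_periodic f :=
  [/\ periodic1 f, forall i, measurable_fun setT (fun x => f x 0 i)
    & (\int[mu]_(x in `[0%R, 1%R]) (enorm (f x) ^+ 2)%:E < +oo)%E].

Definition weak_derivative f g :=
  forall phi : R -> R, periodic1 phi ->
    (forall k x, derivable (phi^`(k)) x 1) ->
  forall i, \int[mu]_(x in `[0, 1]) (f x 0 i * derive1 phi x) =
          - \int[mu]_(x in `[0, 1]) (g x 0 i * phi x).

(* (u, w) ranging over a fundamental domain of R/Z times [-1/2, 1/2] *)
Definition slob_dom : set (R * R) := `[0, 1] `*` `[- 2^-1, 2^-1].

Definition increment f (z : R * R) : 'rV[R]_n := f (z.1 + z.2) - f z.1.

Definition slob_kernel (s : R) (z : R * R) : R := `|z.2| `^ (- 1 - 2 * s).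

Definition slobodeckij2 (s : R) f : \bar R :=
  (\int[mu \x mu]_(z in slob_dom)
     (enorm (increment f z) ^+ 2 * slob_kernel s z)%:E)%E.

(* f is in W^{1+s,2}(R/Z, R^n) and g is its weak derivative *)
Definition sobolev1 (s : R) f g :=
  [/\ L2_periodic f, L2_periodic g, weak_derivative f g
    & (slobodeckij2 s g < +oo)%E].

Definition C1 f := (forall x, derivable f x 1) /\ continuous (derive1 f).

(* The C^1 representatives of the elements of W^{1+s,2}, s > 1/2.  Weak
   derivatives and the seminorm are insensitive to null sets, so nothing is lost
   by naming the continuous representative of the weak derivative. *)
Definition sobolev_curves (s : R) : {pred R -> 'rV[R]_n} :=
  [pred f | `[< C1 f /\ sobolev1 s f (derive1 f) >]].

End periodic_functions.


Section inner_product_norm.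
Context {R : realType} {V : lmodType R} (ip : V -> V -> R).
Hypothesis ipC : forall f g, ip f g = ip g f.
Hypothesis ip_lin : forall a f g h, ip (a *: f + g) h = a * ip f h + ip g h.
Hypothesis ip_ge0 : forall f, 0 <= ip f f.
Hypothesis ip_eq0 : forall f, ip f f = 0 -> f = 0.

Let N (f : V) := Num.sqrt (ip f f).

Let ip0 g : ip 0 g = 0.
Proof. by have := ip_lin 1 0 0 g; rewrite scaler0 addr0 mul1r; lra. Qed.

Let ipZ a f g : ip (a *: f) g = a * ip f g.
Proof. by rewrite -[a *: f]addr0 ip_lin ip0 addr0. Qed.

Let ip_sqr a f g : ip (a *: f + g) (a *: f + g) =
  a ^+ 2 * ip f f + 2 * a * ip f g + ip g g.
Proof.
rewrite ip_lin (ipC f (a *: f + g)) (ipC g (a *: f + g)) !ip_lin (ipC g f).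
ring.
Qed.

Let cauchy_schwarz f g : ip f g <= N f * N g.
Proof.
rewrite -sqrtrM ?ip_ge0//; apply: le_trans (ler_norm _) _.
rewrite -sqrtr_sqr ler_wsqrtr//.
have [/ip_eq0 ->|f0] := eqVneq (ip f f) 0.
  by rewrite !ip0 expr0n mul0r.
have fp : 0 < ip f f by rewrite lt_def f0 ip_ge0.
have := ip_ge0 (- (ip f g / ip f f) *: f + g).
rewrite ip_sqr -(pmulr_lge0 _ fp) => H.
rewrite -subr_ge0; apply: le_trans H _; rewrite le_eqVlt; apply/orP; left.
by apply/eqP; field.
Qed.

Lemma inner_normD f g : N (f + g) <= N f + N g.
Proof.
have nn h : 0 <= N h by exact: sqrtr_ge0.
rewrite -(ler_pXn2r (ltn0Sn 1)) ?nnegrE ?addr_ge0//.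
rewrite sqrrD !sqr_sqrtr ?ip_ge0// -[f in leLHS]scale1r ip_sqr.
have := cauchy_schwarz f g; rewrite /N; lra.
Qed.

Lemma inner_normZ a f : N (a *: f) = `|a| * N f.
Proof.
rewrite /N ipZ ipC ipZ mulrA.
by rewrite -expr2 sqrtrM ?sqr_ge0// sqrtr_sqr.
Qed.

Lemma inner_norm_eq0 f : N f = 0 -> f = 0.
Proof.
move=> /eqP; rewrite sqrtr_eq0 => h; apply: ip_eq0.
by apply/eqP; rewrite eq_le h ip_ge0.
Qed.

End inner_product_norm.

Section euclidean_lemmas.
Context {R : realType} {n : nat}.
Implicit Types x y z : 'rV[R]_n.

Lemma dotC x y : dot x y = dot y x.
Proof. by apply: eq_bigr => i _; rewrite mulrC. Qed.

Lemma dotDl x y z : dot (x + y) z = dot x z + dot y z.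
Proof.
by rewrite /dot -big_split; apply: eq_bigr => i _; rewrite mxE mulrDl.
Qed.

Lemma dotZl (a : R) x y : dot (a *: x) y = a * dot x y.
Proof.
by rewrite /dot big_distrr; apply: eq_bigr => i _ /=; rewrite mxE mulrA.
Qed.

Lemma dot_ge0 x : 0 <= dot x x.
Proof. by apply: sumr_ge0 => i _; rewrite -expr2 sqr_ge0. Qed.

Lemma dot_eq0 x : dot x x = 0 -> x = 0.
Proof.
move=> /eqP; rewrite psumr_eq0 => [/allP h|i _]; last by rewrite -expr2 sqr_ge0.
apply/rowP => i; rewrite mxE; apply/eqP; rewrite -sqrf_eq0 expr2.
by apply: (h i); rewrite mem_index_enum.
Qed.

Lemma enorm2 x : enorm x ^+ 2 = dot x x.
Proof. by rewrite sqr_sqrtr// dot_ge0. Qed.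

Lemma dot_le x y : `|dot x y| <= dot x x + dot y y.
Proof.
rewrite /dot -big_split (le_trans (ler_norm_sum _ _ _))//.
apply: ler_sum => i _ /=.
rewrite ler_norml; apply/andP; split; nra.
Qed.

Lemma dot_lin_sqr (a : R) x y :
  dot (a *: x + y) (a *: x + y)
  = a ^+ 2 * dot x x + 2 * a * dot x y + dot y y.
Proof.
rewrite dotDl dotZl (dotC x (_ + _)) (dotC y (_ + _)) !dotDl !dotZl (dotC y x).
ring.
Qed.

End euclidean_lemmas.

Section sobolev_lemmas.
Context {R : realType} {n : nat}.
Implicit Types f g : R -> 'rV[R]_n.
Notation mu := (@lebesgue_measure R).
Notation T2 := (measurableTypeR R * measurableTypeR R)%type.

Lemma continuous_coord f i : continuous f -> continuous (fun x => f x 0 i).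
Proof.
move=> cf x.
apply: (@continuous_comp _ _ _ f (fun M : 'rV[R]_n => M 0 i)).
  exact: cf.
exact: coord_continuous.
Qed.

Lemma continuous_dot f g : continuous f -> continuous g ->
  continuous (fun x => dot (f x) (g x)).
Proof.
move=> cf cg x; rewrite /dot.
apply: cvg_big => [|i _]; first exact: add_continuous.
apply: cvgM; exact: continuous_coord.
Qed.

Lemma integrable01 (h : R -> R) : continuous h ->
  mu.-integrable `[0, 1] (EFin \o h).
Proof.
move=> ch; apply: continuous_compact_integrable; first exact: segment_compact.
exact: continuous_subspaceT.
Qed.

Lemma C1_continuous f : C1 f -> continuous f.
Proof.
move=> [df _] x; apply: differentiable_continuous.
exact/derivable1_diffP.
Qed.

Lemma derive1_lin (a : R) f g : C1 f -> C1 g ->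
  derive1 (a *: f + g) = a *: (derive1 f) + (derive1 g).
Proof.
move=> [df _] [dg _]; apply/funext => x.
rewrite -[RHS]/(a *: derive1 f x + derive1 g x) !derive1E.
have -> : 'D_1 (a *: f + g) x = 'D_1 (a *: f) x + 'D_1 g x.
  by apply: deriveD; [exact: derivableZ|exact: dg].
by congr (_ + _); apply: deriveZ; exact: df.
Qed.

Lemma C1_lin (a : R) f g : C1 f -> C1 g -> C1 (a *: f + g).
Proof.
move=> hf hg; split.
  move=> x; apply: derivableD; last exact: hg.1.
  by apply: derivableZ; exact: hf.1.
rewrite derive1_lin// => x; apply: cvgD; last exact: hg.2.
by apply: cvgZr; exact: hf.2.
Qed.

Lemma periodic1_derive1 f : periodic1 f -> periodic1 (derive1 f).
Proof.
move=> pf x; rewrite !derive1E /derive.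
suff -> : (fun h : R => h^-1 *: ((f \o shift (x + 1)) (h *: 1) - f (x + 1)))
        = (fun h : R => h^-1 *: ((f \o shift x) (h *: 1) - f x)) by [].
by apply/funext => h /=; rewrite pf addrA pf.
Qed.

Lemma C1_L2 f : periodic1 f -> continuous f -> L2_periodic f.
Proof.
move=> pf cf; split => //.
  move=> i; apply: continuous_measurable_fun; exact: continuous_coord.
have /integrableP[_] := integrable01 (continuous_dot cf cf).
apply: le_lt_trans; rewrite le_eqVlt; apply/orP; left; apply/eqP.
by apply: eq_integral => x _; rewrite enorm2 /= ger0_norm// dot_ge0.
Qed.

Lemma IBP01 (F G : R -> R) :
  (forall x, derivable F x 1) -> continuous (derive1 F) ->
  (forall x, derivable G x 1) -> continuous (derive1 G) ->
  periodic1 F -> periodic1 G ->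
  \int[mu]_(x in `[0, 1]) (F x * derive1 G x) =
  - \int[mu]_(x in `[0, 1]) (derive1 F x * G x).
Proof.
move=> dF cF dG cG pF pG.
have cont (H : R -> R) : (forall x, derivable H x 1) -> continuous H.
  by move=> dH x; apply: differentiable_continuous; apply/derivable1_diffP.
have LR (H : R -> R) : (forall x, derivable H x 1) ->
    derivable_oo_LRcontinuous H 0 1.
  move=> dH; split => //.
    by apply: cvg_at_right_filter; exact: cont.
  by apply: cvg_at_left_filter; exact: cont.
have F10 : F 1 = F 0 by rewrite -[1 in LHS]add0r pF.
have G10 : G 1 = G 0 by rewrite -[1 in LHS]add0r pG.
have cs (H : R -> R) : continuous H -> {within `[0, 1], continuous H}.
  by move=> cH; exact: continuous_subspaceT.
have := @Rintegration_by_parts R F G (derive1 F) (derive1 G) 0 1 ltr01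
  (cs _ cF) (LR _ dF) (fun _ _ => erefl) (cs _ cG) (LR _ dG) (fun _ _ => erefl).
by rewrite F10 G10 subrr sub0r.
Qed.

Lemma C1_weak_derivative f : C1 f -> periodic1 f ->
  weak_derivative f (derive1 f).
Proof.
move=> [df cf] pf phi pphi sphi i.
have dfi x : derivable (fun y => f y 0 i) x 1.
  by have /derivable_mxP := df x; exact.
have fiE : derive1 (fun y => f y 0 i) = (fun y => derive1 f y 0 i).
  by apply/funext => x; rewrite !derive1E derive_mx// mxE.
have cfi : continuous (derive1 (fun y => f y 0 i)).
  by rewrite fiE; exact: continuous_coord.
have cphi : continuous (derive1 phi).
  move=> x; apply: differentiable_continuous; apply/derivable1_diffP.
  exact: (sphi 1%N).
have pfi : periodic1 (fun y => f y 0 i) by move=> x; rewrite pf.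
by have := IBP01 dfi cfi (sphi 0%N) cphi pfi pphi; rewrite fiE.
Qed.

Lemma measurable_slob (s : R) f g : continuous f -> continuous g ->
  measurable_fun [set: T2]
    (fun z => dot (increment f z) (increment g z) * slob_kernel s z).
Proof.
have minc (h : R -> 'rV[R]_n) (i : 'I_n) : continuous h ->
    measurable_fun [set: T2] (fun z => increment h z 0 i).
  move=> ch.
  have mh : measurable_fun [set: R] (fun x => h x 0 i).
    by apply: continuous_measurable_fun; exact: continuous_coord.
  rewrite (_ : (fun z => _) =
      (fun z : T2 => h (z.1 + z.2) 0 i - h z.1 0 i)); last first.
    by apply/funext => z; rewrite !mxE.
  apply: measurable_funB; apply: (measurableT_comp mh) => //.
  by apply: measurable_funD.
move=> cf cg; apply: measurable_funM.
  apply: measurable_sum => i; apply: measurable_funM; exact: minc.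
apply: (measurableT_comp (measurable_powR _)).
exact: measurableT_comp.
Qed.

Lemma measurable_slob_dom : measurable (slob_dom : set T2).
Proof. exact: measurableX. Qed.

Lemma slob_integrable_sqr (s : R) f :
  continuous f -> (slobodeckij2 s f < +oo)%E ->
  (mu \x mu)%E.-integrable (slob_dom : set T2)
    (fun z => (dot (increment f z) (increment f z) * slob_kernel s z)%:E).
Proof.
move=> cf hf; apply/integrableP; split.
  apply/measurable_EFinP; apply: measurable_funTS; exact: measurable_slob.
apply: le_lt_trans hf; rewrite le_eqVlt; apply/orP; left; apply/eqP.
apply: eq_integral => z _.
by rewrite enorm2 gee0_abs// lee_fin mulr_ge0 ?dot_ge0 ?powR_ge0.
Qed.

Lemma slob_integrable (s : R) f g : continuous f -> continuous g ->
  (slobodeckij2 s f < +oo)%E -> (slobodeckij2 s g < +oo)%E ->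
  (mu \x mu)%E.-integrable (slob_dom : set T2)
    (fun z => (dot (increment f z) (increment g z) * slob_kernel s z)%:E).
Proof.
move=> cf cg hf hg.
have := integrableD measurable_slob_dom (slob_integrable_sqr cf hf)
  (slob_integrable_sqr cg hg).
apply: le_integrable; first exact: measurable_slob_dom.
  apply/measurable_EFinP; apply: measurable_funTS; exact: measurable_slob.
move=> z _; rewrite -EFinD !abse_EFin lee_fin -mulrDl !normrM.
rewrite ler_wpM2r// (le_trans (dot_le _ _))// ler_norm//.
Qed.

Lemma increment_lin (a : R) f g z :
  increment (a *: f + g) z = a *: increment f z + increment g z.
Proof.
by rewrite /increment /= scalerBr opprD addrACA.
Qed.

Lemma slob_lin (s a : R) f g : continuous f -> continuous g ->
  (slobodeckij2 s f < +oo)%E -> (slobodeckij2 s g < +oo)%E ->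
  (slobodeckij2 s (a *: f + g)%R < +oo)%E.
Proof.
move=> cf cg hf hg; have mD := measurable_slob_dom.
have Iff := slob_integrable_sqr cf hf.
have Igg := slob_integrable_sqr cg hg.
have Ifg := slob_integrable cf cg hf hg.
have /integrableP[_] := integrableD mD
  (integrableD mD (integrableZl mD (a ^+ 2) Iff) (integrableZl mD (2 * a) Ifg))
  Igg.
apply: le_lt_trans; rewrite le_eqVlt; apply/orP; left; apply/eqP.
apply: eq_integral => z _; rewrite -!EFinM -!EFinD !abse_EFin; congr EFin.
rewrite enorm2 increment_lin.
set u := increment f z; set v := increment g z; set k := slob_kernel s z.
have k0 : 0 <= k by exact: powR_ge0.
rewrite !mulrA -!mulrDl -dot_lin_sqr ger0_norm// mulr_ge0// dot_ge0//.
Qed.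

Lemma sobolev1_lin (s a : R) f g : C1 f -> C1 g ->
  sobolev1 s f (derive1 f) -> sobolev1 s g (derive1 g) ->
  sobolev1 s (a *: f + g) (derive1 (a *: f + g)).
Proof.
move=> cf cg [[pf _ _] [pf' _ _] _ hf] [[pg _ _] [pg' _ _] _ hg].
have cfg := C1_lin a cf cg.
have pfg : periodic1 (a *: f + g).
  by move=> x; rewrite -[LHS]/(a *: f (x + 1) + g (x + 1)) pf pg.
split.
- apply: C1_L2 => //; exact: C1_continuous.
- apply: C1_L2; first exact: periodic1_derive1.
  exact: cfg.2.
- exact: C1_weak_derivative.
- rewrite (derive1_lin a cf cg).
  by apply: (slob_lin _ cf.2 cg.2 hf hg).
Qed.

Lemma sobolev_curves_submod_closed (s : R) :
  submod_closed (@sobolev_curves R n s).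
Proof.
split.
  have C0 : C1 (0 : R -> 'rV[R]_n).
    split => [x|]; first exact: derivable_cst.
    rewrite (_ : derive1 _ = cst 0); first by move=> x; exact: cvg_cst.
    by apply/funext => x; rewrite derive1E derive_cst.
  have p0 : periodic1 (0 : R -> 'rV[R]_n) by [].
  apply/asboolP; split => //; split.
  - apply: C1_L2 => //; exact: C1_continuous.
  - apply: C1_L2; first exact: periodic1_derive1.
    exact: C0.2.
  - exact: C1_weak_derivative.
  - rewrite /slobodeckij2 (eq_integral (cst 0%E)) ?integral0// => z _.
    rewrite (_ : increment _ z = 0); last first.
      rewrite /increment !derive1E.
      by rewrite (derive_cst (0 : 'rV[R]_n)) (derive_cst (0 : 'rV[R]_n)) subrr.
    rewrite enorm2 (_ : dot 0 0 = 0) ?mul0r//.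
    by rewrite /dot big1// => i _; rewrite mxE mul0r.
move=> a f g /asboolP[cf hf] /asboolP[cg hg]; apply/asboolP.
split; first exact: C1_lin.
exact: sobolev1_lin.
Qed.

HB.instance Definition _ (s : R) := GRing.isSubmodClosed.Build R (R -> 'rV[R]_n)
  (@sobolev_curves R n s) (sobolev_curves_submod_closed s).

End sobolev_lemmas.
Section sobolev_space.
Context {R : realType} (n : nat) (s : R).

Record sobolev_curve := SobolevCurve {
  curve_fun :> R -> 'rV[R]_n;
  curve_funP : curve_fun \in sobolev_curves s
}.

HB.instance Definition _ := [isSub for curve_fun].
HB.instance Definition _ := [Choice of sobolev_curve by <:].
HB.instance Definition _ := [SubChoice_isSubLmodule of sobolev_curve by <:].

End sobolev_space.

Section sobolev_inner.
Context {R : realType} {n : nat} {s : R}.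
Implicit Types f g h : sobolev_curve n s.
Notation mu := (@lebesgue_measure R).

(* The inner product inducing the norm
   |f|_{L^2}^2 + |f'|_{L^2}^2 + [f']_{s,2}^2. *)
Definition sobolev_inner f g : R :=
  \int[mu]_(x in `[0, 1]) dot (f x) (g x)
  + \int[mu]_(x in `[0, 1]) dot (derive1 f x) (derive1 g x)
  + \int[(mu \x mu)%E]_(z in slob_dom)
      (dot (increment (derive1 f) z) (increment (derive1 g) z)
       * slob_kernel s z).

Lemma curveP f : C1 f /\ sobolev1 s f (derive1 f).
Proof. exact/asboolP/(curve_funP f). Qed.

Lemma curve_slob f : (slobodeckij2 s (derive1 f) < +oo)%E.
Proof. by have [_ []] := curveP f. Qed.

Let eq_add3 (a b c a' b' c' : R) :
  a = a' -> b = b' -> c = c' -> a + b + c = a' + b' + c'.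
Proof. by move=> -> -> ->. Qed.

Let lin_add3 (k a b c a' b' c' a2 b2 c2 : R) :
  a = k * a' + a2 -> b = k * b' + b2 -> c = k * c' + c2 ->
  a + b + c = k * (a' + b' + c') + (a2 + b2 + c2).
Proof. by move=> -> -> ->; ring. Qed.

Let sum3_eq0 (a b c : R) :
  a + b + c = 0 -> 0 <= a -> 0 <= b -> 0 <= c -> a = 0.
Proof. by move=> *; lra. Qed.

Lemma sobolev_innerC f g : sobolev_inner f g = sobolev_inner g f.
Proof.
apply: eq_add3.
- by apply: eq_Rintegral => x _; exact: dotC.
- by apply: eq_Rintegral => x _; exact: dotC.
- by apply: eq_Rintegral => x _; apply: (congr1 (fun r => r * _)); exact: dotC.
Qed.

Lemma Rintegral_lin d (T : measurableType d) (m : {measure set T -> \bar R})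
    (D : set T) (a : R) (u v w : T -> R) : measurable D ->
  m.-integrable D (EFin \o u) -> m.-integrable D (EFin \o v) ->
  (forall x, w x = a * u x + v x) ->
  \int[m]_(x in D) w x = a * \int[m]_(x in D) u x + \int[m]_(x in D) v x.
Proof.
move=> mD iu iv wE; rewrite -RintegralZl// -RintegralD//.
  exact: eq_Rintegral.
have := integrableZl mD a iu.
by apply: eq_integrable => // x _; rewrite /= EFinM.
Qed.

Lemma sobolev_inner_lin (a : R) f g h :
  sobolev_inner (a *: f + g) h = a * sobolev_inner f h + sobolev_inner g h.
Proof.
have [cf _] := curveP f; have [cg _] := curveP g; have [ch _] := curveP h.
have kf := C1_continuous cf; have kg := C1_continuous cg.
have kh := C1_continuous ch.
have sf := curve_slob f; have sg := curve_slob g; have sh := curve_slob h.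
have E : curve_fun (a *: f + g) = a *: curve_fun f + curve_fun g by [].
rewrite /sobolev_inner E (derive1_lin a cf cg).
apply: lin_add3.
- apply: Rintegral_lin => //.
  + exact: integrable01 (continuous_dot kf kh).
  + exact: integrable01 (continuous_dot kg kh).
  + by move=> x; rewrite dotDl dotZl.
- apply: Rintegral_lin => //.
  + exact: integrable01 (continuous_dot cf.2 ch.2).
  + exact: integrable01 (continuous_dot cg.2 ch.2).
  + by move=> x; rewrite dotDl dotZl.
- apply: Rintegral_lin.
  + exact: measurable_slob_dom.
  + exact: slob_integrable cf.2 ch.2 sf sh.
  + exact: slob_integrable cg.2 ch.2 sg sh.
  + by move=> z; rewrite increment_lin dotDl dotZl mulrDl mulrA.
Qed.

Lemma sobolev_inner_ge0 f : 0 <= sobolev_inner f f.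
Proof.
rewrite !addr_ge0//; apply: Rintegral_ge0 => x _; rewrite ?dot_ge0//.
by rewrite mulr_ge0 ?dot_ge0 ?powR_ge0.
Qed.

Lemma sobolev_inner_eq0 f : sobolev_inner f f = 0 -> f = 0.
Proof.
have [cf [[pf _ _] _ _ _]] := curveP f.
have kf := continuous_dot (C1_continuous cf) (C1_continuous cf).
move/sum3_eq0 => I0; have {}I0 := I0 (Rintegral_ge0 _ (fun x _ => dot_ge0 _))
  (Rintegral_ge0 _ (fun x _ => dot_ge0 _))
  (Rintegral_ge0 _ (fun x _ => mulr_ge0 (dot_ge0 _) (powR_ge0 _ _))).
have If := integrable01 kf.
have ae0 : ae_eq mu `[0, 1] (fun x => (dot (f x) (f x))%:E) (cst 0%E).
  apply/ae_eq_integral_abs => //; first exact: measurable_int If.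
  have fin : (\int[mu]_(x in `[0%R, 1%R]) (dot (f x) (f x))%:E)%E \is a fin_num.
    exact: integrable_fin_num.
  rewrite -[RHS](congr1 EFin I0) fineK//; apply: eq_integral => x _.
  by rewrite gee0_abs// lee_fin dot_ge0.
have z01 x : 0 <= x < 1 -> f x = 0.
  move=> /andP[x0 x1]; apply: dot_eq0; apply/eqP; apply: contraT => fx.
  have N0 : nbhs (dot (f x) (f x)) [set r : R | r != 0].
    by apply: open_nbhs_nbhs; split; [exact: open_neq|].
  have /nbhs_ballP[e /= e0 he] := kf x _ N0.
  have {}ae0 : mu.-negligible `[x, Num.min (x + e / 2) 1].
    apply: negligibleS ae0 => y /=; rewrite in_itv/= le_min => /and3P[xy ye y1].
    move=> H; have y01 : `[0, 1]%classic y.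
      by rewrite /= in_itv/= y1 (le_trans x0).
    have /eqP := EFin_inj (H y01); apply/negP; apply: he => /=.
    by rewrite /ball/= ltr_distlC; apply/andP; split; lra.
  have : mu `[x, Num.min (x + e / 2) 1] = 0%E.
    by apply: measure_negligible => //; exact: measurable_itv.
  rewrite lebesgue_measure_itv /= lte_fin lt_min x1 andbT ltrDl divr_gt0//.
  rewrite -EFinB => -[] /eqP; rewrite subr_eq0 minElt.
  by case: ifPn => _ /eqP ?; lra.
apply: val_inj; apply/funext => x /=.
have pfn k y : f (y + k%:R) = f y.
  elim: k => [|k IH]; first by rewrite addr0.
  by rewrite -natr1 addrA pf.
have pfz (k : int) y : f (y + k%:~R) = f y.
  case: k => k; first exact: pfn.
  by rewrite NegzE mulrNz -[in RHS](subrK k.+1%:~R y) pfn.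
rewrite -[x](subrK (Num.floor x)%:~R) pfz z01//.
by rewrite subr_ge0 ge_floor ltrBlDl -[X in _ + X]/(1%:~R) -intrD lt_succ_floor.
Qed.

End sobolev_inner.

HB.instance Definition _ (R : realType) (n : nat) (s : R) :=
  Lmodule_isNormed.Build R (sobolev_curve n s)
    (inner_normD (@sobolev_innerC R n s) sobolev_inner_lin sobolev_inner_ge0
       sobolev_inner_eq0)
    (inner_normZ (@sobolev_innerC R n s) sobolev_inner_lin)
    (inner_norm_eq0 sobolev_inner_ge0 sobolev_inner_eq0).

Lemma sobolev_normE (R : realType) (n : nat) (s : R) (f : sobolev_curve n s) :
  `|f| = Num.sqrt (sobolev_inner f f).
Proof. by []. Qed.

Section curves.
Context {R : realType} {n : nat}.
Implicit Types c : R -> 'rV[R]_n.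

Definition embedded c := {in `[0, 1[ &, injective c}.

Definition regular c := forall u, 0 < enorm (derive1 c u).

(* With x / 0 = 0, the reciprocal of this function vanishes at collinear
   triples, as it should: there R^(p,2) = +oo. *)
Definition menger_R (p : R) (x y z : 'rV[R]_n) : R :=
  (enorm (z - x) * enorm (y - x) * enorm (z - y)) `^ p
  / wedge_norm (z - x) (y - x) ^+ 2.

Definition intM (p : R) c : \bar R :=
  (\int[lebesgue_measure]_(u1 in `[0%R, 1%R])
   \int[lebesgue_measure]_(u2 in `[0%R, 1%R])
   \int[lebesgue_measure]_(u3 in `[0%R, 1%R])
     (enorm (derive1 c u1) * enorm (derive1 c u2) * enorm (derive1 c u3)
      / menger_R p (c u1) (c u2) (c u3))%:E)%E.

End curves.

(* W^{3/2 p - 2, 2}(R/Z, R^n), where 3/2 p - 2 = 1 + s *)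
Definition menger_space (R : realType) (n : nat) (p : R) :=
  sobolev_curve n (3 / 2 * p - 3).

Section flow.
Context {R : realType} {n : nat} {p : R}.
Notation H := (menger_space n p).
Implicit Types (c g h v : H) (gamma : R -> H).

Definition energy c : R := fine (intM p c).

(* The finiteness of the energy around c
   makes [energy], whose value is meaningless where the integral is infinite,
   agree with it there.  Embeddedness of c is deliberately not required. *)
Definition is_gradient c g :=
  [/\ \forall c' \near c, intM p (curve_fun c') \is a fin_num,
      differentiable energy c
    & forall h, 'd energy c h = sobolev_inner g h].

(* Differential of Sigma(c) = log |c'| *)
Definition DSigma c h (u : R) : R :=
  dot (derive1 c u) (derive1 h u) / enorm (derive1 c u) ^+ 2.

Definition null_DSigma c : set H := [set h | DSigma c h = cst 0].

Definition is_orthogonal_projection (N : set H) g v :=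
  N v /\ forall h, N h -> sobolev_inner (g - v) h = 0.

Definition is_projected_gradient c v :=
  exists2 g, is_gradient c g & is_orthogonal_projection (null_DSigma c) g v.

(* C^1([0, +oo), H), with a one-sided derivative at 0 *)
Definition C1_halfline gamma := exists dgamma : R -> H,
  (forall t, 0 <= t ->
     (x - t)^-1 *: (gamma x - gamma t) @[x --> within `[0, +oo[ t^']
       --> dgamma t)
  /\ {within `[0, +oo[, continuous dgamma}.

Definition is_projected_flow (gamma0 : H) gamma :=
  [/\ C1_halfline gamma, gamma 0 = gamma0
    & forall t, 0 < t -> exists2 v, is_projected_gradient (gamma t) v
                                 & is_derive t 1 gamma (- v)].

End flow.

Section knot_classes.
Context {R : realType} {n : nat}.
Implicit Types (c : R -> 'rV[R]_n) (K : set (R -> 'rV[R]_n)).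

Definition closed_curve_embedding c :=
  [/\ continuous c, periodic1 c & embedded c].

(* [Phi] is a level preserving homeomorphism of [0,1] x R^n, with inverse
   [Psi], starting at the identity and carrying c to c' at time 1. *)
Definition ambient_isotopic c c' :=
  exists Phi Psi : R -> 'rV[R]_n -> 'rV[R]_n,
  [/\ {within `[0, 1] `*` setT, continuous (fun z => Phi z.1 z.2)},
      {within `[0, 1] `*` setT, continuous (fun z => Psi z.1 z.2)},
      forall t, 0 <= t <= 1 -> cancel (Phi t) (Psi t) /\ cancel (Psi t) (Phi t),
      Phi 0 = id
    & Phi 1 \o c = c'].

Definition knot_class c : set (R -> 'rV[R]_n) :=
  [set c' | closed_curve_embedding c' /\ ambient_isotopic c c'].

Definition polygonal c := exists (m : nat) (tau : nat -> R),
  [/\ tau 0%N = 0, tau m = 1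
    & forall i, (i < m)%N -> tau i < tau i.+1 /\
      exists a b : 'rV[R]_n, forall u, tau i <= u <= tau i.+1 -> c u = a + u *: b].

Definition tame_knot_class K :=
  exists c, [/\ closed_curve_embedding c, polygonal c & K = knot_class c].

End knot_classes.

(* Main.v *)
From HB Require Import structures.
Require Import Defs.
From mathcomp Require Import all_boot all_order all_algebra.
From mathcomp Require Import all_classical all_reals all_analysis.
From mathcomp Require Import measurable_realfun ring lra.

Set Implicit Arguments.
Unset Strict Implicit.
Unset Printing Implicit Defensive.

Import Order.TTheory GRing.Theory Num.Theory.
Import numFieldNormedType.Exports.

Local Open Scope ring_scope.
Local Open Scope classical_set_scope.

(* The equation preserves |gamma'|, since its right-hand side lies in the null space of
   D Sigma; so gamma(., t) stays regular.  A gradient of the energy exists at gamma(., t),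
   hence the energy is finite in a neighbourhood of it in H.  This forces embeddedness: at
   a double point c a = c b, adding to c a small multiple of a smooth function which
   vanishes at a and b, and whose derivative vanishes at b but not at a, makes the crossing
   transversal; near a transversal crossing the integrand is of order r ^ (4 - 3 p) on a
   set of measure r ^ 3 for every small r, so the energy is infinite for p > 7/3.

   The knot class is locally constant in t.  H embeds into C^1, by telescoping the averages
   of the derivative over dyadic intervals.  A regular embedded C^1 curve c is
   bi-Lipschitz, so for a C^1-close curve c1 the map c u |-> c1 u - c u has Lipschitz
   constant at most 1/2 on the image of c; extended to a map V on the whole space with the
   same constant, it gives the ambient isotopy x |-> x + t V x from c to c1. *)

(** Finiteness of the energy at [c] alone would not exclude double points: a doubly covered circle
    has finite energy for p < 8/3, all its double points being tangential. This is why the curve is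
    perturbed inside H, and why finiteness on a neighbourhood is used. The range of p acts through s
    = 3p/2 - 3, the order of the seminorm put on the derivative. The bound p > 7/3 says s > 1/2, so
    that successive dyadic averages of the derivative differ by a geometric sequence of ratio 2^(1/2
    - s); it also says 7 - 3p < 0, so that the boxes at a crossing carry energy of unbounded order
    r^(7 - 3p). The bound p < 8/3 says s < 1, which gives every periodic curve with Lipschitz
    derivative a finite seminorm and so keeps the perturbation in H. Row vectors carry the sup norm.
    Hence the Lipschitz extension can be made one coordinate at a time, by a scalar formula, without
    enlarging the constant 1/2; being below 1, this constant makes each stage of the isotopy
    invertible by Banach's fixed point theorem. *)

(** * Integral bounds *)

(* No measurability: the integral of a nonnegative function is a supremum
   over the simple functions below it. *)
Lemma ge0_le_integral_nonmeasurable d (T : measurableType d) (R : realType)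
    (mu : {measure set T -> \bar R}) (D : set T) (f g : T -> \bar R) :
  (forall x, D x -> 0 <= f x)%E -> (forall x, D x -> f x <= g x)%E ->
  (\int[mu]_(x in D) f x <= \int[mu]_(x in D) g x)%E.
Proof.
move=> f0 fg.
rewrite !ge0_integralE//; last by move=> x Dx; rewrite (le_trans (f0 x Dx)) ?fg.
apply: ereal_sup_le => _ [h hf <-]; exists h => // x.
apply: le_trans (hf x) _; rewrite !patchE.
by case: ifPn => // /set_mem /fg.
Qed.

Lemma le_integral_subset d (T : measurableType d) (R : realType)
    (m : {measure set T -> \bar R}) (A D : set T) (f g : T -> \bar R) :
  A `<=` D -> (forall x, A x -> 0 <= f x)%E -> (forall x, A x -> f x <= g x)%E ->
  (forall x, D x -> 0 <= g x)%E ->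
  (\int[m]_(x in A) f x <= \int[m]_(x in D) g x)%E.
Proof.
move=> AD f0 fg g0; rewrite integral_mkcond [leRHS]integral_mkcond.
apply: ge0_le_integral_nonmeasurable => x _; first exact: erestrict_ge0.
rewrite !patchE; case: ifPn => [/set_mem Ax|_].
  by rewrite (mem_set (AD _ Ax)); exact: fg.
by case: ifPn => // /set_mem /g0.
Qed.

Lemma le_integral_cst d (T : measurableType d) (R : realType)
    (mu : {measure set T -> \bar R}) (D A : set T) (f : T -> \bar R) (k : R) :
  measurable A -> A `<=` D -> (0 <= k)%R -> (forall x, D x -> 0 <= f x)%E ->
  (forall x, A x -> k%:E <= f x)%E ->
  (k%:E * mu A <= \int[mu]_(x in D) f x)%E.
Proof.
move=> mA AD k0 f0 kf.
by rewrite -(integral_cst mu mA); apply: le_integral_subset.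
Qed.

Lemma le_integral_itv (R : realType) (D : set R) (f : R -> \bar R) (k a b : R) :
  a <= b -> `[a, b] `<=` D -> 0 <= k -> (forall x, D x -> 0 <= f x)%E ->
  (forall x, (a <= x <= b)%R -> (k%:E <= f x)%E) ->
  ((k * (b - a))%:E <= \int[lebesgue_measure]_(x in D) f x)%E.
Proof.
move=> ab abD k0 f0 kf.
have <- : (k%:E * lebesgue_measure `[a, b] = (k * (b - a))%:E)%E.
  rewrite lebesgue_measure_itv /= lte_fin; case: ifPn => [_|].
    by rewrite EFinM EFinB.
  by rewrite -leNgt => ba; rewrite mule0 (_ : b - a = 0) ?mulr0//; lra.
by apply: le_integral_cst => // x /=; rewrite in_itv /=; exact: kf.
Qed.

(** * Blow-up of the energy at a transversal crossing *)

Lemma derivable_expansion (R : realType) (V : normedModType R) (f : R -> V)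
    (a e : R) : derivable f a 1 -> 0 < e ->
  exists2 d, 0 < d & forall s, `|s| <= d ->
    `|f (a + s) - f a - s *: derive1 f a| <= e * `|s|.
Proof.
move=> df e0.
have cf : h^-1 *: (f (h + a) - f a) @[h --> 0^'] --> derive1 f a.
  rewrite derive1E; move: df; rewrite /derivable /derive => df.
  rewrite (_ : (fun h : R => _) = (fun h : R => h^-1 *: ((f \o shift a) (h *: 1) - f a))) //.
  by apply/funext => h /=; rewrite [h *: 1]mulr1.
move/cvgrPdist_le/(_ _ e0): cf => /nbhs_ballP[d /= d0 hd].
exists (d / 2); first by rewrite divr_gt0.
move=> s sd; have [->|s0] := eqVneq s 0.
  by rewrite addr0 scale0r subrr subr0 normr0 normr0 mulr0.
have H : `|derive1 f a - s^-1 *: (f (s + a) - f a)| <= e.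
  apply: (hd s _ s0); rewrite /ball /= sub0r normrN.
  by apply: le_lt_trans sd _; lra.
rewrite (addrC a).
have -> : f (s + a) - f a - s *: derive1 f a =
   - (s *: (derive1 f a - s^-1 *: (f (s + a) - f a))).
  by rewrite scalerBr scalerA divff// scale1r opprB.
by rewrite normrN normrZ mulrC ler_wpM2r.
Qed.

Lemma ler_coord_norm (R : realType) (n : nat) (x : 'rV[R]_n) (i : 'I_n) :
  `|x 0 i| <= `|x|.
Proof.
rewrite /Num.Def.normr /= mx_normrE.
exact: (le_bigmax_cond _ (fun i => `|x i.1 i.2|) (isT : xpredT (0, i))).
Qed.

Lemma ler_enorm_coord (R : realType) (n : nat) (x : 'rV[R]_n) (i : 'I_n) :
  `|x 0 i| <= enorm x.
Proof.
rewrite -sqrtr_sqr ler_wsqrtr// /dot (bigD1 i)//= -expr2 lerDl.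
by apply: sumr_ge0 => j _; rewrite -expr2 sqr_ge0.
Qed.

Lemma enorm_le_coord (R : realType) (n : nat) (x : 'rV[R]_n) (l : R) :
  (0 < n)%N -> (forall i, `|x 0 i| <= l) -> enorm x <= n%:R * l.
Proof.
move=> n0 xl; have l0 : 0 <= l by apply: le_trans (xl (Ordinal n0)).
have n1 : 1 <= n%:R :> R by rewrite ler1n.
rewrite -(ger0_norm (mulr_ge0 (ler0n _ n) l0)) -sqrtr_sqr ler_wsqrtr//.
apply: (@le_trans _ _ (n%:R * l ^+ 2)); last first.
  by rewrite exprMn ler_wpM2r ?sqr_ge0// expr2 ler_peMl.
rewrite /dot mulr_natl -[X in _ *+ X](card_ord n) -sumr_const.
apply: ler_sum => i _; rewrite -expr2 -[leLHS]real_normK ?num_real//.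
by rewrite lerXn2r ?nnegrE.
Qed.

Lemma wedge_norm_ge (R : realType) (n : nat) (x y : 'rV[R]_n) (i j : 'I_n) :
  (x 0 i * y 0 j - x 0 j * y 0 i) ^+ 2 <= wedge_norm x y ^+ 2.
Proof.
have S0 : 0 <= \sum_(i < n) \sum_(j < n | (i < j)%N)
    (x 0 i * y 0 j - x 0 j * y 0 i) ^+ 2.
  by apply: sumr_ge0 => k _; apply: sumr_ge0 => l _; exact: sqr_ge0.
rewrite sqr_sqrtr//; wlog ij : i j / (i < j)%N => [H|].
  have [|ji|/val_inj ->] := ltngtP i j; first exact: H.
    by have := H j i ji; rewrite -sqrrN opprB.
  by rewrite subrr expr0n.
rewrite (bigD1 i)//= (bigD1 j)//= -addrA lerDl addr_ge0//.
  by apply: sumr_ge0 => l _; exact: sqr_ge0.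
by apply: sumr_ge0 => k _; apply: sumr_ge0 => l _; exact: sqr_ge0.
Qed.

Section wedge_estimate.
Context {R : realType}.
Implicit Types x y z L eta : R.

(** A single 2x2 minor of (z - x) ^ (y - x): up to sign, twice the area of the triangle projected to
    a coordinate plane. One nonzero minor is enough to bound the wedge norm from below. *)
Definition wedge2 x1 x2 y1 y2 z1 z2 : R :=
  (z1 - x1) * (y2 - x2) - (z2 - x2) * (y1 - x1).

Lemma mul_perturb (p p0 q q0 L eta : R) :
  `|p - p0| <= eta -> `|q - q0| <= eta -> `|p0| <= L -> `|q0| <= L -> eta <= L ->
  `|p * q - p0 * q0| <= 3 * eta * L.
Proof.
move=> hp hq hp0 hq0 eL.
have -> : p * q - p0 * q0 = (p - p0) * (q - q0) + (p - p0) * q0 + p0 * (q - q0).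
  by ring.
have e0 : 0 <= eta by exact: le_trans hp.
have L0 : 0 <= L by exact: le_trans hp0.
apply: le_trans (ler_normD _ _) _.
apply: le_trans (lerD (ler_normD _ _) (lexx _)) _.
rewrite !normrM.
have h1 : `|p - p0| * `|q - q0| <= eta * L.
  by apply: ler_pM => //; exact: le_trans eL.
have h2 : `|p - p0| * `|q0| <= eta * L by apply: ler_pM.
have h3 : `|p0| * `|q - q0| <= L * eta by apply: ler_pM.
lra.
Qed.

(** Differences of coordinates double both [eta] and [L], so [mul_perturb] costs 3 * 2 * 2 = 12 for
    each of the two products. *)
Lemma wedge2_perturb (x1 x2 y1 y2 z1 z2 a1 a2 b1 b2 c1 c2 L eta : R) :
  `|x1 - a1| <= eta -> `|x2 - a2| <= eta -> `|y1 - b1| <= eta ->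
  `|y2 - b2| <= eta -> `|z1 - c1| <= eta -> `|z2 - c2| <= eta ->
  `|a1| <= L -> `|a2| <= L -> `|b1| <= L -> `|b2| <= L ->
  `|c1| <= L -> `|c2| <= L -> eta <= L ->
  `|wedge2 x1 x2 y1 y2 z1 z2 - wedge2 a1 a2 b1 b2 c1 c2| <= 24 * eta * L.
Proof.
move=> hx1 hx2 hy1 hy2 hz1 hz2 ha1 ha2 hb1 hb2 hc1 hc2 eL; rewrite /wedge2.
have D (u v u0 v0 : R) : `|u - u0| <= eta -> `|v - v0| <= eta ->
    `|u - v - (u0 - v0)| <= 2 * eta.
  by rewrite !ler_norml => /andP[? ?] /andP[? ?]; apply/andP; split; lra.
have B (u v : R) : `|u| <= L -> `|v| <= L -> `|u - v| <= 2 * L.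
  by rewrite !ler_norml => /andP[? ?] /andP[? ?]; apply/andP; split; lra.
have eL2 : 2 * eta <= 2 * L by lra.
have := mul_perturb (D _ _ _ _ hz1 hx1) (D _ _ _ _ hy2 hx2)
  (B _ _ hc1 ha1) (B _ _ hb2 ha2) eL2.
have := mul_perturb (D _ _ _ _ hz2 hx2) (D _ _ _ _ hy1 hx1)
  (B _ _ hc2 ha2) (B _ _ hb1 ha1) eL2.
rewrite !ler_norml => /andP[? ?] /andP[? ?]; apply/andP; split; lra.
Qed.

(** [A] and [B] stand for the tangents of the two branches. For points exactly on the tangent lines
    the minor is s (t' - t) (A1 B2 - A2 B1), and the separated ranges of [t] and [t'] make both s
    and t' - t at least r. The perturbation error is at most 24 (e r) (4 r M) = 96 e M r^2, which
    the hypothesis with 192 makes at most half of the main term. *)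
Lemma wedge2_crossing (A1 A2 B1 B2 x1 x2 y1 y2 z1 z2 s t t' r M e : R) :
  0 < r -> r <= s -> s <= 2 * r -> r <= t -> t <= 2 * r ->
  3 * r <= t' -> t' <= 4 * r ->
  `|A1| <= M -> `|A2| <= M -> `|B1| <= M -> `|B2| <= M ->
  e <= M -> 192 * e * M <= `|A1 * B2 - A2 * B1| ->
  `|x1 - s * A1| <= e * r -> `|x2 - s * A2| <= e * r ->
  `|y1 - t * B1| <= e * r -> `|y2 - t * B2| <= e * r ->
  `|z1 - t' * B1| <= e * r -> `|z2 - t' * B2| <= e * r ->
  r ^+ 2 * (`|A1 * B2 - A2 * B1| / 2) <= `|wedge2 x1 x2 y1 y2 z1 z2|.
Proof.
move=> r0 s1 s2 t1 t2 u1 u2 hA1 hA2 hB1 hB2 eM eD hx1 hx2 hy1 hy2 hz1 hz2.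
have S (k X : R) : `|X| <= M -> 0 <= k -> k <= 4 * r -> `|k * X| <= 4 * r * M.
  by move=> hX k0 kr; rewrite normrM (ger0_norm k0); apply: ler_pM.
have := @wedge2_perturb x1 x2 y1 y2 z1 z2 (s * A1) (s * A2) (t * B1) (t * B2)
  (t' * B1) (t' * B2) (4 * r * M) (e * r) hx1 hx2 hy1 hy2 hz1 hz2.
have M0 : 0 <= M by exact: le_trans hA1.
have -> : wedge2 (s * A1) (s * A2) (t * B1) (t * B2) (t' * B1) (t' * B2) =
  s * (t' - t) * (A1 * B2 - A2 * B1) by rewrite /wedge2; ring.
set D := A1 * B2 - A2 * B1 in eD *; set W := wedge2 _ _ _ _ _ _.
move=> H.
have {}H : `|W - s * (t' - t) * D| <= 24 * (e * r) * (4 * r * M).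
  by apply: H; rewrite ?S//; nra.
have main : r ^+ 2 * `|D| <= `|s * (t' - t) * D|.
  rewrite normrM ler_wpM2r// ger0_norm; nra.
have : `|s * (t' - t) * D| <= `|W| + `|W - s * (t' - t) * D|.
  rewrite -[X in `|X| <= _](subKr W).
  exact: ler_normB.
nra.
Qed.

End wedge_estimate.

(** In the exponent 7, the squared wedge accounts for 4 and the volume of a box for 3, against the
    3p from the three distances. The threshold [d] solves N' d^q = C / 2 with q = 3p - 7. *)
Lemma powR_blowup (R : realType) (C N p : R) : 0 < C -> 7 / 3 < p ->
  exists2 d, 0 < d & forall r, 0 < r <= d -> N * (r ^+ 3) `^ p < C * r ^+ 7.
Proof.
move=> C0 hp; set q := 3 * p - 7; have q0 : 0 < q by rewrite /q; lra.
set N' := `|N| + 1; have N0 : 0 < N' by rewrite ltr_wpDl.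
exists ((C / (2 * N')) `^ q^-1); first by rewrite powR_gt0 ?divr_gt0 ?mulr_gt0.
move=> r /andP[r0 rd].
have rq : r `^ q <= C / (2 * N').
  have -> : C / (2 * N') = ((C / (2 * N')) `^ q^-1) `^ q.
    by rewrite -powRrM mulVf ?powRr1 ?lt0r_neq0// divr_ge0 ?mulr_ge0// ltW.
  by rewrite ge0_ler_powR ?nnegrE ?powR_ge0// ltW.
have -> : (r ^+ 3) `^ p = r ^+ 7 * r `^ q.
  rewrite -powR_mulrn ?ltW// -powRrM -powR_mulrn ?ltW// -powRD; last first.
    by apply/implyP => _; rewrite lt0r_neq0.
  by congr (_ `^ _); rewrite /q; lra.
have r7 : 0 < r ^+ 7 by rewrite exprn_gt0.
have : N * r `^ q < C.
  apply: (@le_lt_trans _ _ (N' * (C / (2 * N')))).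
    apply: (@le_trans _ _ (N' * r `^ q)).
      by rewrite ler_wpM2r ?powR_ge0// /N' (le_trans (ler_norm _))// lerDl.
    by rewrite ler_wpM2l// ltW.
  have -> : N' * (C / (2 * N')) = C / 2 by field; rewrite lt0r_neq0.
  lra.
by rewrite mulrCA (mulrC C) ltr_pM2l.
Qed.

(** A nonzero minor forces the three points to be pairwise distinct and not collinear, so every
    division in [menger_R] is a genuine one and the conventional value at 0 does not interfere. *)
Lemma menger_integrand_ge (R : realType) (n : nat) (p k W l v1 v2 v3 : R)
    (x y z : 'rV[R]_n) (i j : 'I_n) :
  0 <= p -> 0 <= k -> k <= v1 -> k <= v2 -> k <= v3 -> 0 < W ->
  W <= `|wedge2 (x 0 i) (x 0 j) (y 0 i) (y 0 j) (z 0 i) (z 0 j)| ->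
  enorm (z - x) <= l -> enorm (y - x) <= l -> enorm (z - y) <= l ->
  k ^+ 3 * (W ^+ 2 / (l ^+ 3) `^ p) <= v1 * v2 * v3 / menger_R p x y z.
Proof.
move=> p0 k0 kv1 kv2 kv3 W0 hW l1 l2 l3.
have Wsq : W ^+ 2 <= wedge_norm (z - x) (y - x) ^+ 2.
  apply: le_trans (wedge_norm_ge _ _ i j); rewrite !mxE -/(wedge2 _ _ _ _ _ _).
  rewrite -[leRHS]real_normK ?num_real//.
  by rewrite ler_sqr ?nnegrE ?(ltW W0).
have w0 : 0 < wedge_norm (z - x) (y - x) ^+ 2.
  by apply: lt_le_trans Wsq; rewrite exprn_gt0.
have E0 (u : 'rV[R]_n) : 0 <= enorm u by exact: sqrtr_ge0.
have En (u : 'rV[R]_n) : u != 0 -> 0 < enorm u.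
  move=> u0; rewrite lt_def E0 andbT; apply: contra u0 => /eqP u0.
  by apply/eqP/dot_eq0; rewrite -enorm2 u0 expr0n.
have nz1 : z - x != 0.
  apply: contraL hW => /eqP/subr0_eq ->; rewrite -ltNge.
  by rewrite /wedge2 !subrr !mul0r subrr normr0.
have nz2 : y - x != 0.
  apply: contraL hW => /eqP/subr0_eq ->; rewrite -ltNge.
  by rewrite /wedge2 !subrr !mulr0 subrr normr0.
have nz3 : z - y != 0.
  apply: contraL hW => /eqP/subr0_eq ->; rewrite -ltNge.
  by rewrite /wedge2 (mulrC (y 0 i - _)) subrr normr0.
have P0 : 0 < enorm (z - x) * enorm (y - x) * enorm (z - y).
  by rewrite !mulr_gt0 ?En.
rewrite /menger_R invf_div; apply: ler_pM.
- by rewrite exprn_ge0.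
- by rewrite divr_ge0 ?powR_ge0 ?sqr_ge0.
- rewrite !exprS expr0 mulr1 mulrA; apply: ler_pM => //; rewrite ?mulr_ge0//.
  by apply: ler_pM.
- apply: ler_pM => //; first exact: sqr_ge0.
    by rewrite invr_ge0 powR_ge0.
  rewrite lef_pV2 ?posrE ?powR_gt0//; last first.
    by rewrite exprn_gt0// (lt_le_trans _ l1)// En.
  rewrite ge0_ler_powR ?nnegrE ?(ltW P0) ?exprn_ge0 ?(le_trans _ l1)//.
  rewrite !exprS expr0 mulr1 mulrA; apply: ler_pM; rewrite ?mulr_ge0//.
  by apply: ler_pM.
Qed.

Lemma continuous_pos_near (R : realType) (f : R -> R) (a : R) :
  {for a, continuous f} -> 0 < f a ->
  exists2 d, 0 < d & forall s, `|s| <= d -> f a / 2 <= f (a + s).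
Proof.
move=> cf fa.
have /cvgrPdist_le/(_ (f a / 2)) := cf.
rewrite divr_gt0// => /(_ isT) /nbhs_ballP[d /= d0 hd].
exists (d / 2); first by rewrite divr_gt0.
move=> s sd; have : `|f a - f (a + s)| <= f a / 2.
  apply: hd; rewrite /ball /= opprD addNKr normrN.
  by apply: le_lt_trans sd _; lra.
by rewrite ler_norml => /andP[_ ?]; lra.
Qed.

Lemma continuous_enorm_derive1 (R : realType) (n : nat) (c : R -> 'rV[R]_n) :
  C1 c -> continuous (fun u => enorm (derive1 c u)).
Proof.
move=> [_ cc] u; apply: (@continuous_comp _ _ _ (fun u => dot (derive1 c u) (derive1 c u))).
  exact: (continuous_dot cc cc).
exact: sqrt_continuous.
Qed.

Lemma enorm_ge0 (R : realType) (n : nat) (x : 'rV[R]_n) : 0 <= enorm x.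
Proof. exact: sqrtr_ge0. Qed.

Lemma enorm0 (R : realType) (n : nat) : enorm (0 : 'rV[R]_n) = 0.
Proof. by rewrite /enorm /dot big1 ?sqrtr0// => i _; rewrite mxE mul0r. Qed.

Lemma enorm_gt0 (R : realType) (n : nat) (x : 'rV[R]_n) (i : 'I_n) :
  x 0 i != 0 -> 0 < enorm x.
Proof.
by move=> xi; apply: lt_le_trans (ler_enorm_coord x i); rewrite normr_gt0.
Qed.

Lemma crossing_wedge (R : realType) (n : nat) (c : R -> 'rV[R]_n)
    (a b : R) (A B : 'rV[R]_n) (i j : 'I_n) :
  derivable c a 1 -> derivable c b 1 -> derive1 c a = A -> derive1 c b = B ->
  c a = c b -> A 0 i * B 0 j != A 0 j * B 0 i ->
  exists d W l, [/\ 0 < d, 0 < W, 0 < l &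
    forall r s t t', 0 < r <= d -> r <= s <= 2 * r -> r <= t <= 2 * r ->
      3 * r <= t' <= 4 * r ->
      let x := c (a + s) in let y := c (b + t) in let z := c (b + t') in
      [/\ r ^+ 2 * W <= `|wedge2 (x 0 i) (x 0 j) (y 0 i) (y 0 j) (z 0 i) (z 0 j)|,
        enorm (z - x) <= l * r, enorm (y - x) <= l * r & enorm (z - y) <= l * r]].
Proof.
move=> da db EA EB cab; rewrite -subr_eq0.
move ED : (A 0 i * B 0 j - A 0 j * B 0 i) => D Dn0.
have n0 : (0 < n)%N by exact: leq_ltn_trans (ltn_ord i).
have D0 : 0 < `|D| by rewrite normr_gt0.
have [M M0 [MA MB]] : exists2 M, 0 < M &
    (forall k, `|A 0 k| <= M) /\ (forall k, `|B 0 k| <= M).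
  exists (1 + enorm A + enorm B).
    by rewrite -addrA ltr_wpDr// addr_ge0// enorm_ge0.
  have := enorm_ge0 A; have := enorm_ge0 B.
  by split => k; [have := ler_enorm_coord A k|have := ler_enorm_coord B k]; lra.
have [e e0 [eM eD]] : exists2 e, 0 < e & e <= M /\ 192 * e * M <= `|D|.
  exists (Num.min M (`|D| / (192 * M))).
    by rewrite lt_min M0 divr_gt0// mulr_gt0.
  split; first by rewrite ge_min lexx.
  rewrite (mulrC 192) -mulrA -ler_pdivlMr ?mulr_gt0//.
  by rewrite ge_min lexx orbT.
(* The parameters go up to 4 r, so a remainder e / 4 times the parameter stays below e * r. *)
have e4 : 0 < e / 4 by rewrite divr_gt0.
have [d1 d10 ha] := derivable_expansion da e4.
have [d2 d20 hb] := derivable_expansion db e4.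
exists (Num.min (d1 / 4) (d2 / 4)), (`|D| / 2), (n%:R * (16 * M)); split.
- by rewrite lt_min !divr_gt0.
- by rewrite divr_gt0.
- by rewrite !mulr_gt0// ltr0n.
move=> r s t t' /andP[r0]; rewrite le_min => /andP[r1 r2].
move=> /andP[s1 s2] /andP[t1 t2] /andP[u1 u2] x y z.
pose P := c a.
have H4 (h : R) (Q : 'rV[R]_n) (X : 'rV[R]_n) (q : 'I_n) : r <= h -> h <= 4 * r ->
    `|X - P - h *: Q| <= e / 4 * `|h| -> `|(X - P) 0 q - h * Q 0 q| <= e * r.
  move=> x1 x2; have -> : `|h| = h by rewrite ger0_norm//; lra.
  move=> H; have := le_trans (ler_coord_norm _ q) H.
  have -> : (X - P - h *: Q) 0 q = (X - P) 0 q - h * Q 0 q by rewrite !mxE.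
  by move=> {}H; apply: le_trans H _; nra.
have sz (X : 'rV[R]_n) (h : R) (Q : 'rV[R]_n) :
    (forall q, `|(X - P) 0 q - h * Q 0 q| <= e * r) ->
    r <= h -> h <= 4 * r -> (forall q, `|Q 0 q| <= M) ->
    forall q, `|(X - P) 0 q| <= 8 * M * r.
  move=> H x1 x2 HQ q; have := H q; have := HQ q.
  move: ((X - P) 0 q) (Q 0 q) => v w.
  rewrite !ler_norml => /andP[h1 h2] /andP[h3 h4].
  have h5 : e * r <= M * r by rewrite ler_wpM2r// ltW.
  have h6 : h * w <= 4 * r * M by clear -x1 x2 r0 M0 h1 h2; nra.
  have h7 : - (4 * r * M) <= h * w by clear -x1 x2 r0 M0 h1 h2; nra.
  by clear -h3 h4 h5 h6 h7 r0 M0; apply/andP; split; nra.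
have [hs hs4] : r <= s /\ s <= 4 * r by clear -r0 s1 s2; split; lra.
have [ht ht4] : r <= t /\ t <= 4 * r by clear -r0 t1 t2; split; lra.
have [hu hu4] : r <= t' /\ t' <= 4 * r by clear -r0 u1 u2; split; lra.
have hx q : `|(x - P) 0 q - s * A 0 q| <= e * r.
  by apply: H4 => //; rewrite -EA; apply: ha; clear -r0 r1 hs hs4; rewrite ger0_norm; lra.
have hy q : `|(y - P) 0 q - t * B 0 q| <= e * r.
  by apply: H4 => //; rewrite -EB /P cab; apply: hb; clear -r0 r2 ht ht4; rewrite ger0_norm; lra.
have hz q : `|(z - P) 0 q - t' * B 0 q| <= e * r.
  by apply: H4 => //; rewrite -EB /P cab; apply: hb; clear -r0 r2 hu hu4; rewrite ger0_norm; lra.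
have zx := sz _ _ _ hx hs hs4 MA.
have zy := sz _ _ _ hy ht ht4 MB.
have zz := sz _ _ _ hz hu hu4 MB.
have lb (X Y : 'rV[R]_n) : (forall q, `|(X - P) 0 q| <= 8 * M * r) ->
    (forall q, `|(Y - P) 0 q| <= 8 * M * r) ->
    enorm (X - Y) <= n%:R * (16 * M) * r.
  move=> hX hY; rewrite -mulrA; apply: enorm_le_coord => // q.
  have -> : (X - Y) 0 q = (X - P) 0 q - (Y - P) 0 q by rewrite !mxE; ring.
  have := hX q; have := hY q; move: ((X - P) 0 q) ((Y - P) 0 q) => v w.
  rewrite !ler_norml => /andP[h1 h2] /andP[h3 h4]; clear -h1 h2 h3 h4.
  by apply/andP; split; lra.
split; [|exact: lb|exact: lb|exact: lb].
have -> : wedge2 (x 0 i) (x 0 j) (y 0 i) (y 0 j) (z 0 i) (z 0 j) =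
    wedge2 ((x - P) 0 i) ((x - P) 0 j) ((y - P) 0 i)
      ((y - P) 0 j) ((z - P) 0 i) ((z - P) 0 j).
  rewrite /wedge2 !mxE.
  by move: (x 0 i) (x 0 j) (y 0 i) (y 0 j) (z 0 i) (z 0 j) (P 0 i) (P 0 j) => *; ring.
rewrite -ED.
apply: (@wedge2_crossing _ (A 0 i) (A 0 j) (B 0 i) (B 0 j)
  _ _ _ _ _ _ s t t' r M e) => //.
by rewrite ED.
Qed.

(* Applied at a double point c a = c b, with m a multiple of r ^ (4 - 3 p). *)
Lemma intM_ge_boxes (R : realType) (n : nat) (p : R) (c : R -> 'rV[R]_n)
    (a b r m : R) :
  0 <= a -> 0 <= b -> 0 < r -> a + 2 * r <= 1 -> b + 4 * r <= 1 -> 0 <= m ->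
  (forall s t t', r <= s <= 2 * r -> r <= t <= 2 * r -> 3 * r <= t' <= 4 * r ->
    m <= enorm (derive1 c (a + s)) * enorm (derive1 c (b + t)) *
      enorm (derive1 c (b + t')) /
      menger_R p (c (a + s)) (c (b + t)) (c (b + t'))) ->
  ((m * r ^+ 3)%:E <= intM p c)%E.
Proof.
move=> a0 b0 r0 a1 b1 m0 pt.
have nn (u1 u2 u3 : R) : 0 <= enorm (derive1 c u1) * enorm (derive1 c u2) *
      enorm (derive1 c u3) / menger_R p (c u1) (c u2) (c u3).
  by rewrite mulr_ge0 ?invr_ge0 ?divr_ge0 ?powR_ge0 ?sqr_ge0// !mulr_ge0// enorm_ge0.
have sub (x y : R) : 0 <= x -> y <= 1 -> `[x, y] `<=` (`[0%R, 1%R] : set R).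
  move=> x0 y1 v /=; rewrite !in_itv/= => /andP[h1 h2].
  by rewrite (le_trans x0)// (le_trans h2).
have -> : m * r ^+ 3 = m * (b + 4 * r - (b + 3 * r)) * (b + 2 * r - (b + r)) *
   (a + 2 * r - (a + r)) by ring.
apply: le_integral_itv; [lra|apply: sub; lra| | |].
- by rewrite !mulr_ge0//; lra.
- by move=> u1 _; apply: integral_ge0 => u2 _; apply: integral_ge0 => u3 _; rewrite lee_fin.
move=> u1 hu1; apply: le_integral_itv; [lra|apply: sub; lra| | |].
- by rewrite !mulr_ge0//; lra.
- by move=> u2 _; apply: integral_ge0 => u3 _; rewrite lee_fin.
move=> u2 hu2; apply: le_integral_itv; [lra|apply: sub; lra|exact: m0| |].
  by move=> u3 _; rewrite lee_fin.
move=> u3 hu3; rewrite lee_fin.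
have := pt (u1 - a) (u2 - b) (u3 - b).
by rewrite !(addrC _ (_ - _)) !subrK; apply; lra.
Qed.

(** The boxes extend only to the right of [a] and [b], which may be 0; the room left in [0, 1] on
    that side is what 4 r <= 1 - a and 4 r <= 1 - b secure. There the speeds are at least [k], and
    the resulting lower bound [m * r ^+ 3], a constant times r^(7 - 3p), exceeds any proposed finite
    value [N]. *)
Lemma intM_transversal (R : realType) (n : nat) (p : R) (c : R -> 'rV[R]_n)
    (a b : R) (i j : 'I_n) :
  7 / 3 < p -> C1 c -> 0 <= a < 1 -> 0 <= b < 1 -> c a = c b ->
  derive1 c a 0 i * derive1 c b 0 j != derive1 c a 0 j * derive1 c b 0 i ->
  intM p c \isn't a fin_num.
Proof.
move=> hp hc /andP[a0 a1] /andP[b0 b1] cab.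
move EA : (derive1 c a) => A; move EB : (derive1 c b) => B AB.
have [A0 B0] : 0 < enorm A /\ 0 < enorm B.
  have [Ai|Ai] := eqVneq (A 0 i) 0; have [Aj|Aj] := eqVneq (A 0 j) 0;
  have [Bi|Bi] := eqVneq (B 0 i) 0; have [Bj|Bj] := eqVneq (B 0 j) 0;
  move: AB; rewrite ?Ai ?Aj ?Bi ?Bj ?mul0r ?mulr0 ?eqxx// => _; split;
  by [exact: (enorm_gt0 Ai)|exact: (enorm_gt0 Aj)|exact: (enorm_gt0 Bi)|exact: (enorm_gt0 Bj)].
have [d1 [W [l [d10 W0 l0 hw]]]] := crossing_wedge (hc.1 a) (hc.1 b) EA EB cab AB.
have ca : {for a, continuous (fun u => enorm (derive1 c u))}.
  exact: continuous_enorm_derive1.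
have cb : {for b, continuous (fun u => enorm (derive1 c u))}.
  exact: continuous_enorm_derive1.
have [d3 d30 ka] : exists2 d, 0 < d & forall s, `|s| <= d ->
    enorm A / 2 <= enorm (derive1 c (a + s)).
  by have := continuous_pos_near ca; rewrite EA => /(_ A0).
have [d4 d40 kb] : exists2 d, 0 < d & forall s, `|s| <= d ->
    enorm B / 2 <= enorm (derive1 c (b + s)).
  by have := continuous_pos_near cb; rewrite EB => /(_ B0).
have [k k0 [kA kB]] : exists2 k, 0 < k & k <= enorm A / 2 /\ k <= enorm B / 2.
  exists (Num.min (enorm A / 2) (enorm B / 2)); first by rewrite lt_min !divr_gt0.
  by rewrite !ge_min !lexx orbT.
apply/negP => fin; move EN : (fine (intM p c)) => N.
have C0 : 0 < k ^+ 3 * W ^+ 2 by rewrite mulr_gt0 ?exprn_gt0// divr_gt0.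
have [d5 d50 hd5] := powR_blowup (N * (l ^+ 3) `^ p) C0 hp.
have [r r0 [r1 r3 r4 [ra rb r5]]] : exists2 r, 0 < r & [/\ r <= d1, 4 * r <= d3,
    4 * r <= d4 & [/\ 4 * r <= 1 - a, 4 * r <= 1 - b & r <= d5]].
  pose q := \big[Num.min/d5]_(x <- [:: d1; d3 / 4; d4 / 4; (1 - a) / 4; (1 - b) / 4]) x.
  have : q <= q by []; rewrite {2}/q !big_cons big_nil !le_min.
  move=> /and5P[q1 q3 q4 qa /andP[qb q5]]; exists q.
    by rewrite /q !big_cons big_nil !lt_min; lra.
  by clear -q1 q3 q4 qa qb q5; split; [lra|lra|lra|split; [lra|lra|]].
have {}hd5 : N * (l ^+ 3) `^ p * (r ^+ 3) `^ p < k ^+ 3 * W ^+ 2 * r ^+ 7.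
  by apply: hd5; rewrite r0.
pose m := k ^+ 3 * ((r ^+ 2 * W) ^+ 2 / ((l * r) ^+ 3) `^ p).
have m0 : 0 <= m.
  by rewrite mulr_ge0 ?exprn_ge0 ?(ltW k0)// divr_ge0 ?powR_ge0// sqr_ge0.
have : ((m * r ^+ 3)%:E <= intM p c)%E.
  apply: (@intM_ge_boxes _ _ _ _ a b) => //; [lra|lra|].
  move=> s t t' hs ht hu.
  have r1' : 0 < r <= d1 by rewrite r0.
  have [hW h1 h2 h3] := hw r s t t' r1' hs ht hu.
  move: hs ht hu => /andP[s1 s2] /andP[t1 t2] /andP[u1 u2].
  apply: (@menger_integrand_ge _ _ _ _ _ _ _ _ _ _ _ _ i j) => //.
  - lra.
  - exact: ltW.
  - by apply: le_trans kA (ka s _); clear -r0 r3 s1 s2; rewrite ger0_norm; lra.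
  - by apply: le_trans kB (kb t _); clear -r0 r4 t1 t2; rewrite ger0_norm; lra.
  - by apply: le_trans kB (kb t' _); clear -r0 r4 u1 u2; rewrite ger0_norm; lra.
  - by rewrite mulr_gt0 ?exprn_gt0.
rewrite -(fineK fin) lee_fin EN leNgt => /negP; apply.
have -> : m * r ^+ 3 = k ^+ 3 * W ^+ 2 * r ^+ 7 / ((l ^+ 3) `^ p * (r ^+ 3) `^ p).
  rewrite -powRM ?exprn_ge0 ?(ltW r0) ?(ltW l0)// -exprMn /m; move: (_ `^ p) => Z; ring.
rewrite ltr_pdivlMr ?mulr_gt0 ?powR_gt0 ?exprn_gt0//.
by rewrite mulrA.
Qed.

(** * The embedding of the Sobolev space into C^1 *)

Section averages.
Context {R : realType}.
Notation mu := (@lebesgue_measure R).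

Lemma integral_derive (F G : R -> R) (a b : R) : a < b ->
  (forall x, is_derive x (1 : R) F (G x)) -> continuous G ->
  (\int[mu]_(x in `[a, b]) (G x)%:E = (F b - F a)%:E)%E.
Proof.
move=> ab dF cG; have cF x : {for x, continuous F}.
  apply: differentiable_continuous; apply/derivable1_diffP.
  by case: (dF x).
rewrite EFinB; apply: continuous_FTC2 => //.
- exact: continuous_subspaceT.
- split.
  + by move=> x _; case: (dF x).
  + by apply: cvg_at_right_filter; exact: cF.
  + by apply: cvg_at_left_filter; exact: cF.
- by move=> x _; rewrite derive1E; case: (dF x).
Qed.

(** Jensen's inequality for the square, by integrating the tangent line bound 2 l G - l^2 <= G^2 at
    the mean value [l] of G. *)
Lemma integral_sqr_ge (F G : R -> R) (a b : R) : a < b ->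
  (forall x, is_derive x (1 : R) F (G x)) -> continuous G ->
  (((F b - F a) ^+ 2 / (b - a))%:E <= \int[mu]_(x in `[a, b]) (G x ^+ 2)%:E)%E.
Proof.
move=> ab dF cG; set l := (F b - F a) / (b - a).
have ba : b - a != 0 by rewrite subr_eq0 gt_eqF.
have I (g : R -> R) : continuous g -> mu.-integrable `[a, b] (EFin \o g).
  move=> cg; apply: continuous_compact_integrable; first exact: segment_compact.
  exact: continuous_subspaceT.
have cG2 : continuous (fun x => G x ^+ 2).
  by move=> x; rewrite /=; apply: cvgM; exact: cG.
have cH : continuous (fun x => 2 * l * G x - l ^+ 2).
  by move=> x; apply: cvgB; [apply: cvgM; [exact: cvg_cst|exact: cG]|exact: cvg_cst].
have dH x : is_derive x (1 : R) (fun x => 2 * l * F x - l ^+ 2 * x) (2 * l * G x - l ^+ 2).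
  have h1 := dF x.
  apply: is_derive_eq; rewrite /GRing.scale/=; ring.
have -> : (F b - F a) ^+ 2 / (b - a) =
    (2 * l * F b - l ^+ 2 * b) - (2 * l * F a - l ^+ 2 * a).
  rewrite /l; field.
  exact: ba.
rewrite -(integral_derive ab dH cH); apply: le_integral => //; [exact: I cH|exact: I cG2|].
move=> x _; rewrite lee_fin -subr_ge0.
have -> : G x ^+ 2 - (2 * l * G x - l ^+ 2) = (G x - l) ^+ 2 by ring.
exact: sqr_ge0.
Qed.
End averages.

Section slobodeckij_averages.
Context {R : realType}.
Notation mu := (@lebesgue_measure R).
Notation T2 := (measurableTypeR R * measurableTypeR R)%type.

Lemma slob_dom_fubini (h : R * R -> R) :
  measurable_fun [set: T2] h -> (forall z, 0 <= h z) ->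
  (\int[mu \x mu]_(z in slob_dom) (h z)%:E =
   \int[mu]_(u in `[0%R, 1%R]) \int[mu]_(w in `[(- 2^-1)%R, 2^-1%R]) (h (u, w))%:E)%E.
Proof.
move=> mh h0; rewrite integral_mkcond fubini_tonelli1; last 2 first.
- apply/(measurable_restrictT _ measurable_slob_dom).
  by apply: measurable_funTS; apply/measurable_EFinP.
- by move=> z; apply: erestrict_ge0 => y _; rewrite lee_fin.
rewrite [RHS]integral_mkcond; apply: eq_integral => u _.
rewrite /fubini_F /= patchE; case: ifPn => [/set_mem u01|u01].
  rewrite [RHS]integral_mkcond; apply: eq_integral => w _.
  rewrite !patchE; congr (if _ then _ else _).
  by apply/idP/idP => /set_mem H; apply/mem_set => //; case: H.
rewrite integral0_eq// => w _; rewrite patchE; case: ifPn => // /set_mem [/= H _].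
by case/negP: u01; exact/mem_set.
Qed.

Lemma is_derive_translate (F : R -> R) (u w d : R) :
  is_derive (u + w) (1 : R) F d -> is_derive w (1 : R) (fun w => F (u + w)) d.
Proof.
rewrite addrC => dF; have := @is_derive1_comp R F (shift u) w d 1 dF (is_derive_shift w 1 u).
by rewrite mulr1 (_ : F \o _ = fun w => F (u + w))//; apply/funext => x /=; rewrite addrC.
Qed.

(* Jensen's inequality in both variables; the averages of G over the two
   intervals are difference quotients of F. *)
Lemma dyadic_average_step (F G : R -> R) (s D al be r : R) :
  (forall x, is_derive x (1 : R) F (G x)) -> continuous G -> 0 <= s ->
  (\int[mu \x mu]_(z in slob_dom)
     ((G (z.1 + z.2) - G z.1) ^+ 2 * slob_kernel s z)%:E <= D%:E)%E ->
  0 < r -> r <= 2^-1 -> 0 <= be -> be + r / 2 <= 1 -> al <= be ->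
  be + r / 2 <= al + r ->
  r `^ (1 - 2 * s) / 2 *
    ((F (al + r) - F al) / r - (F (be + r / 2) - F be) / (r / 2)) ^+ 2 <= D.
Proof.
move=> dF cG s0 hD r0 r2 be0 be1 albe ber.
have mG : measurable_fun [set: R] G by exact: continuous_measurable_fun.
pose h (z : R * R) := (G (z.1 + z.2) - G z.1) ^+ 2 * slob_kernel s z.
have h0 z : 0 <= h z by rewrite mulr_ge0 ?sqr_ge0// powR_ge0.
have mh : measurable_fun [set: T2] h.
  apply: measurable_funM; last first.
    by apply: (measurableT_comp (measurable_powR _)); exact: measurableT_comp.
  apply: measurable_funX; apply: measurable_funB; apply: (measurableT_comp mG) => //.
  by apply: measurable_funD.
rewrite -/h (slob_dom_fubini mh h0) in hD.
rewrite -lee_fin; apply: le_trans hD.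
(* [k] bounds the kernel from below for 0 < |w| <= r, and the nesting of the two intervals keeps all
   increments that occur within this range. *)
pose k := r `^ (- 1 - 2 * s).
have k0 : 0 < k by exact: powR_gt0.
(* [H'] is r times the mean of G over [al, al + r] minus G u, and [H] is its primitive. Over
   [be, be + r/2] it increases by r^2 / 2 times the difference X of the two quotients, so Jensen
   yields (k / r) (r^2 X / 2)^2 / (r / 2) = k r^2 X^2 / 2. *)
pose H u := u * (F (al + r) - F al) - r * F u.
pose H' u := F (al + r) - F al - r * G u.
have dH u : is_derive u (1 : R) H (H' u).
  have h1 := dF u.
  by apply: is_derive_eq; rewrite /H' /GRing.scale/=; ring.
have cH' : continuous H'.
  by move=> u; apply: cvgB; [exact: cvg_cst|apply: cvgM; [exact: cvg_cst|exact: cG]].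
apply: (@le_trans _ _ (\int[mu]_(u in `[be, (be + r / 2)%R]) (k / r * H' u ^+ 2)%:E)%E).
  have bb : be < be + r / 2 by lra.
  under eq_integral do rewrite EFinM.
  rewrite ge0_integralZl//=; last 3 first.
  - apply/measurable_EFinP; apply: measurable_funTS; apply: measurable_funX.
    exact: continuous_measurable_fun.
  - by move=> x _; rewrite lee_fin sqr_ge0.
  - by rewrite lee_fin divr_ge0// ltW.
  have := integral_sqr_ge bb dH cH'; rewrite -(@lee_pmul2l _ (k / r)%:E)//; last first.
    by rewrite lte_fin divr_gt0.
  apply: le_trans; rewrite -EFinM lee_fin.
  have -> : r `^ (1 - 2 * s) = k * r ^+ 2.
    rewrite -powR_mulrn ?ltW// -powRD; last by apply/implyP => _; rewrite gt_eqF.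
    by congr (_ `^ _); ring.
  rewrite le_eqVlt; apply/orP; left; apply/eqP; rewrite /H.
  field.
  by rewrite mulNr addrAC subrr add0r gt_eqF.
apply: le_integral_subset.
- by move=> u /=; rewrite !in_itv/= => /andP[? ?]; apply/andP; split; lra.
- by move=> u _; rewrite lee_fin mulr_ge0 ?sqr_ge0// divr_ge0// ltW.
- move=> u; rewrite /= in_itv/= => /andP[u0 u1].
  have dK w : is_derive w (1 : R) (fun w => F (u + w) - w * G u) (G (u + w) - G u).
    have h1 := dF (u + w).
    have h2 := is_derive_translate h1.
    by apply: is_derive_eq; rewrite /GRing.scale/=; ring.
  have cK : continuous (fun w => G (u + w) - G u).
    move=> w; apply: cvgB; last exact: cvg_cst.
    apply: (@continuous_comp _ _ _ (fun w => u + w) G); last exact: cG.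
    by apply: cvgD; [exact: cvg_cst|exact: cvg_id].
  have ab : al - u < al + r - u by lra.
  apply: (@le_trans _ _ (\int[mu]_(w in `[(al - u)%R, (al + r - u)%R])
      (k * (G (u + w) - G u) ^+ 2)%:E)%E).
    under eq_integral do rewrite EFinM.
    rewrite ge0_integralZl//=; last 3 first.
    - apply/measurable_EFinP; apply: measurable_funTS; apply: measurable_funX.
      exact: continuous_measurable_fun.
    - by move=> x _; rewrite lee_fin sqr_ge0.
    - by rewrite lee_fin ltW.
    have := integral_sqr_ge ab dK cK; rewrite -(@lee_pmul2l _ k%:E)//.
    apply: le_trans; rewrite -EFinM lee_fin.
    rewrite [u + (al + r - u)]addrC [u + (al - u)]addrC !subrK.
    rewrite le_eqVlt; apply/orP; left; apply/eqP; rewrite /H'.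
    field; lra.
  apply: le_integral_subset.
  + by move=> w /=; rewrite !in_itv/= => /andP[? ?]; apply/andP; split; lra.
  + by move=> w _; rewrite lee_fin mulr_ge0 ?sqr_ge0// ltW.
  + move=> w; rewrite /= in_itv/= => /andP[w0 w1]; rewrite lee_fin /h /= mulrC.
    (* At [w = 0] the kernel takes the conventional value 0 and is not above [k]; the increment
       vanishes there instead. *)
    have [->|wn0] := eqVneq w 0.
      by rewrite addr0 subrr expr0n !mul0r.
    rewrite ler_wpM2l ?sqr_ge0// /k /slob_kernel /=.
    rewrite (_ : - 1 - 2 * s = - (1 + 2 * s)); last by ring.
    rewrite !powRN lef_pV2 ?posrE ?powR_gt0 ?normr_gt0//.
    rewrite ge0_ler_powR ?nnegrE//; [lra|exact: ltW|].
    by rewrite ler_norml; apply/andP; split; lra.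
  + by move=> w _; rewrite lee_fin.
- by move=> u _; apply: integral_ge0 => w _; rewrite lee_fin.
Qed.
End slobodeckij_averages.

(** The exponent is shifted so that the longest interval has length 1/2, the largest increment in
    [slob_dom]. *)
Definition dyadic (R : realType) (k : nat) : R := 2^-1 ^+ k.+1.

Definition dyadic_quotient (R : realType) (F : R -> R) (x sg : R) (k : nat) : R :=
  (F (x - sg * dyadic R k + dyadic R k) - F (x - sg * dyadic R k)) / dyadic R k.

Section embedding.
Context {R : realType}.
Notation mu := (@lebesgue_measure R).

Lemma dyadic_gt0 k : 0 < dyadic R k.
Proof. by rewrite exprn_gt0// invr_gt0. Qed.

Lemma dyadic_le k : dyadic R k <= 2^-1.
Proof. by rewrite /dyadic exprS ger_pMr ?invr_gt0// exprn_ile1// ?invr_ge0//; lra. Qed.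

Lemma dyadicS k : dyadic R k.+1 = dyadic R k / 2.
Proof. by rewrite /dyadic exprSr. Qed.

Lemma dyadic_small (d : R) : 0 < d -> exists k, dyadic R k <= d.
Proof.
move=> d0.
have h : `|2^-1 : R| < 1 by rewrite ger0_norm; lra.
have /cvgrPdist_le/(_ _ d0) [k _ hk] := cvg_expr h.
exists k; have := hk k.+1 (leqnSn k); rewrite /= sub0r normrN ger0_norm//.
Qed.

(* sg = 0 gives the intervals [x, x + 2^-k.+1], sg = 1 the intervals
   [x - 2^-k.+1, x]. *)
Lemma dyadic_quotient_step (F G : R -> R) (s D x sg : R) (k : nat) :
  (forall x, is_derive x (1 : R) F (G x)) -> continuous G -> 0 <= s -> 0 <= D ->
  (\int[mu \x mu]_(z in slob_dom)
     ((G (z.1 + z.2) - G z.1) ^+ 2 * slob_kernel s z)%:E <= D%:E)%E ->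
  0 <= sg <= 1 -> sg / 2 <= x -> x <= (sg + 1) / 2 ->
  `|dyadic_quotient F x sg k - dyadic_quotient F x sg k.+1| <=
    Num.sqrt (2 * D) * (2^-1 `^ (s - 2^-1)) ^+ k.+1.
Proof.
move=> dF cG s0 D0 hD /andP[sg0 sg1] x0 x1.
rewrite /dyadic_quotient dyadicS.
have -> : (2^-1 `^ (s - 2^-1)) ^+ k.+1 = dyadic R k `^ (s - 2^-1) :> R.
  by rewrite -powR_mulrn ?powR_ge0// -powRrM mulrC powRrM powR_mulrn// invr_ge0.
have := dyadic_gt0 k; have := dyadic_le k; move: (dyadic R k) => r r2 r0.
have h1 : sg * r <= sg / 2 by rewrite ler_wpM2l.
have h2 : (1 - sg) * r <= (1 - sg) / 2 by rewrite ler_wpM2l// subr_ge0.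
have h3 : 0 <= sg * r by rewrite mulr_ge0// ltW.
have h4 : 0 <= (1 - sg) * r by rewrite mulr_ge0 ?(ltW r0)// subr_ge0.
have := @dyadic_average_step R F G s D (x - sg * r) (x - sg * (r / 2)) r dF cG s0 hD r0 r2.
move=> /(_ ltac:(lra)) /(_ ltac:(lra)) /(_ ltac:(lra)) /(_ ltac:(lra)).
set X := _ - _ => H.
have rs : 0 < r `^ (1 - 2 * s) by exact: powR_gt0.
rewrite -sqrtr_sqr.
have -> : r `^ (s - 2^-1) = Num.sqrt ((r `^ (1 - 2 * s))^-1).
  rewrite -powRN -(ger0_norm (powR_ge0 _ _)) -sqrtr_sqr; congr (Num.sqrt _).
  by rewrite -powR_mulrn ?powR_ge0// -powRrM; congr (_ `^ _); field.
rewrite -sqrtrM ?mulr_ge0// ler_wsqrtr//.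
by rewrite ler_pdivlMr// mulrC; lra.
Qed.

Lemma geometric_bound (u : nat -> R) (C q : R) : 0 <= C -> 0 <= q < 1 ->
  (forall k, `|u k - u k.+1| <= C * q ^+ k.+1) ->
  forall k, `|u k - u 0%N| <= C * (q / (1 - q)).
Proof.
move=> C0 /andP[q0 q1] hu k; have q1' : 0 < 1 - q by rewrite subr_gt0.
(* The induction runs on the exact partial geometric sum, of which the claimed bound is the
   limit. *)
apply: (@le_trans _ _ (C * (q / (1 - q) * (1 - q ^+ k)))); last first.
  rewrite ler_wpM2l// ler_piMr ?divr_ge0 ?(ltW q1')//.
  by rewrite gerBl exprn_ge0.
elim: k => [|k IH].
  by rewrite subrr normr0 expr0 subrr !mulr0.
rewrite -(subrK (u k) (u k.+1)) -addrA (le_trans (ler_normD _ _))//.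
rewrite distrC; apply: le_trans (lerD (hu k) IH) _.
rewrite -mulrDr le_eqVlt; apply/orP; left; apply/eqP; congr (_ * _).
by rewrite !exprS; field; rewrite gt_eqF.
Qed.

(** The quotients tend to [G x], and none of them is farther from the initial one than the full
    geometric sum. The side [sg] keeps every interval inside [0, 1], where the seminorm controls it:
    right of x when x <= 1/2, left of x when x >= 1/2. *)
Lemma derivative_bound (F G : R -> R) (s D x sg : R) :
  (forall x, is_derive x (1 : R) F (G x)) -> continuous G -> 2^-1 < s -> 0 <= D ->
  (\int[mu \x mu]_(z in slob_dom)
     ((G (z.1 + z.2) - G z.1) ^+ 2 * slob_kernel s z)%:E <= D%:E)%E ->
  (sg = 0 \/ sg = 1) -> sg / 2 <= x -> x <= (sg + 1) / 2 ->
  `|G x| <= `|dyadic_quotient F x sg 0| +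
    Num.sqrt (2 * D) * (2^-1 `^ (s - 2^-1) / (1 - 2^-1 `^ (s - 2^-1))).
Proof.
move=> dF cG s2 D0 hD sg01 x0 x1.
set q := _ `^ _.
have hq : 0 <= q < 1.
  rewrite powR_ge0 /=; have : q < 1 `^ (s - 2^-1).
    by rewrite gt0_ltr_powR ?nnegrE//; lra.
  by rewrite powR1.
have sg1 : 0 <= sg <= 1 by case: sg01 => ->; rewrite ?lexx ler01.
have s0 : 0 <= s by lra.
have K := geometric_bound (sqrtr_ge0 _) hq
  (fun k => dyadic_quotient_step k dF cG s0 D0 hD sg1 x0 x1).
apply/ler_addgt0Pr => e e0.
have [dFx EG] : derivable F x 1 /\ derive1 F x = G x.
  by case: (dF x) => h1 h2; rewrite derive1E.
have [d d0 hd] := derivable_expansion dFx e0.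
have [k hk] := dyadic_small d0.
have : `|dyadic_quotient F x sg k - G x| <= e.
  have := dyadic_gt0 k; rewrite /dyadic_quotient; move: (dyadic R k) hk => r rd r0.
  case: sg01 => ->.
    rewrite mul0r subr0; have := hd r; rewrite ger0_norm ?(ltW r0)// EG => /(_ rd) H.
    have -> : (F (x + r) - F x) / r - G x = (F (x + r) - F x - r *: G x) / r.
      by rewrite /GRing.scale /=; field; rewrite gt_eqF.
    by rewrite normrM normfV (gtr0_norm r0) ler_pdivrMr.
  rewrite mul1r subrK; have := hd (- r).
  rewrite normrN ger0_norm ?(ltW r0)// EG => /(_ rd) H.
  have -> : (F x - F (x - r)) / r - G x = - (F (x - r) - F x - (- r) *: G x) / r.
    by rewrite /GRing.scale /=; field; rewrite gt_eqF.
  by rewrite normrM normrN normfV (gtr0_norm r0) ler_pdivrMr.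
have := K k; move: (dyadic_quotient F x sg k) (dyadic_quotient F x sg 0) => a b h1 h2.
have -> : G x = (G x - a) + (a - b) + b by ring.
apply: le_trans (ler_normD _ _) _.
have := ler_normD (G x - a) (a - b); rewrite (distrC (G x)).
lra.
Qed.
End embedding.

Lemma periodic1_int (R : realType) (T : Type) (f : R -> T) (k : int) x :
  periodic1 f -> f (x + k%:~R) = f x.
Proof.
move=> pf; have pfn m y : f (y + m%:R) = f y.
  elim: m => [|m IH]; first by rewrite addr0.
  by rewrite -natr1 addrA pf.
case: k => k; first exact: pfn.
by rewrite NegzE mulrNz -[in RHS](subrK k.+1%:~R x) pfn.
Qed.

Lemma floor_frac (R : realType) (x : R) : 0 <= x - (Num.floor x)%:~R < 1.
Proof.
by rewrite subr_ge0 ge_floor ltrBlDl -[X in _ + X]/(1%:~R) -intrD lt_succ_floor.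
Qed.

Lemma norm_le_coord (R : realType) (n : nat) (x : 'rV[R]_n) (l : R) :
  0 <= l -> (forall i, `|x 0 i| <= l) -> `|x| <= l.
Proof.
move=> l0 xl; rewrite /Num.Def.normr /= mx_normrE.
by apply/bigmax_leP; split => // -[i j] _ /=; rewrite ord1.
Qed.

Section sobolev_embedding.
Context {R : realType} {n : nat} {s : R}.
Notation mu := (@lebesgue_measure R).
Implicit Types f : sobolev_curve n s.

Lemma is_derive_coord (c : R -> 'rV[R]_n) i : C1 c ->
  forall x, is_derive x (1 : R) (fun y => c y 0 i) (derive1 c x 0 i).
Proof.
move=> [dc _] x; have /derivable_mxP dcx := dc x.
apply: DeriveDef; first exact: dcx.
by rewrite derive1E derive_mx// mxE.
Qed.

Lemma curve_periodic f : periodic1 f.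
Proof. by have [_ [[]]] := curveP f. Qed.

Lemma sobolev_norm_ge f :
  \int[mu]_(x in `[0, 1]) dot (derive1 f x) (derive1 f x) <= `|f| ^+ 2 /\
  \int[(mu \x mu)%E]_(z in slob_dom)
      (dot (increment (derive1 f) z) (increment (derive1 f) z)
       * slob_kernel s z) <= `|f| ^+ 2.
Proof.
rewrite sobolev_normE sqr_sqrtr ?sobolev_inner_ge0// /sobolev_inner.
have h0 : 0 <= \int[mu]_(x in `[0, 1]) dot (f x) (f x).
  by apply: Rintegral_ge0 => x _; exact: dot_ge0.
have h1 : 0 <= \int[mu]_(x in `[0, 1]) dot (derive1 f x) (derive1 f x).
  by apply: Rintegral_ge0 => x _; exact: dot_ge0.
have h2 : 0 <= \int[(mu \x mu)%E]_(z in slob_dom)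
      (dot (increment (derive1 f) z) (increment (derive1 f) z)
       * slob_kernel s z).
  by apply: Rintegral_ge0 => x _; rewrite mulr_ge0 ?dot_ge0 ?powR_ge0.
by split; [rewrite addrAC lerDr addr_ge0|rewrite lerDr addr_ge0].
Qed.

Lemma sqr_coord_le_dot (v : 'rV[R]_n) i : v 0 i ^+ 2 <= dot v v.
Proof.
rewrite /dot (bigD1 i)//= -expr2 lerDl.
by apply: sumr_ge0 => j _; rewrite -expr2 sqr_ge0.
Qed.

Lemma coord_slob_le f i :
  (\int[mu \x mu]_(z in slob_dom)
     ((derive1 f (z.1 + z.2) 0 i - derive1 f z.1 0 i) ^+ 2 * slob_kernel s z)%:E
   <= (`|f| ^+ 2)%:E)%E.
Proof.
have [cf _] := curveP f.
have /integrable_fin_num fin := slob_integrable_sqr cf.2 (curve_slob f).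
have [_] := sobolev_norm_ge f; rewrite -lee_fin /Rintegral fineK; last first.
  exact: fin measurable_slob_dom.
apply: le_trans; apply: ge0_le_integral_nonmeasurable => z _.
  by rewrite lee_fin mulr_ge0 ?sqr_ge0 ?powR_ge0.
rewrite lee_fin ler_wpM2r ?powR_ge0//.
by have := sqr_coord_le_dot (increment (derive1 f) z) i; rewrite !mxE.
Qed.

(** The initial term of the telescoping: a quotient over length 1/2, controlled by the L^2 norm of
    the derivative. *)
Lemma coord_H1_le f i (a : R) : 0 <= a -> a + 2^-1 <= 1 ->
  `|(f (a + 2^-1) 0 i - f a 0 i) / 2^-1| <= Num.sqrt (2 * `|f| ^+ 2).
Proof.
move=> a0 a1; have [cf _] := curveP f.
have cG : continuous (fun x => derive1 f x 0 i) by apply: continuous_coord; exact: cf.2.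
have ab : a < a + 2^-1 by rewrite ltrDl invr_gt0.
have /integrable_fin_num fin := integrable01 (continuous_dot cf.2 cf.2).
have [+ _] := sobolev_norm_ge f; rewrite -lee_fin /Rintegral fineK; last exact: fin.
have := integral_sqr_ge ab (is_derive_coord i cf) cG.
rewrite addrAC subrr add0r; set X := _ - _ => h1 h2.
rewrite -sqrtr_sqr ler_wsqrtr// expr_div_n.
suff : X ^+ 2 / 2^-1 <= `|f| ^+ 2 by rewrite !invrK => ?; rewrite -exprVn invrK; lra.
rewrite -lee_fin; apply: (le_trans h1); apply: le_trans h2.
apply: le_integral_subset => x /=.
- by rewrite !in_itv/= => /andP[? ?]; apply/andP; split; lra.
- by move=> _; rewrite lee_fin sqr_ge0.
- by move=> _; rewrite lee_fin; exact: sqr_coord_le_dot.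
- by move=> _; rewrite lee_fin dot_ge0.
Qed.
End sobolev_embedding.

Lemma sobolev_derive1_le (R : realType) (n : nat) (s : R) : 2^-1 < s ->
  exists2 K, 0 < K & forall (f : sobolev_curve n s) x, `|derive1 f x| <= K * `|f|.
Proof.
move=> s2; set q := (2^-1 : R) `^ (s - 2^-1).
(* The absolute value makes the constant visibly positive without comparing [q] with 1. *)
pose Q := `|q / (1 - q)|.
exists (Num.sqrt 2 * (1 + Q)).
  by rewrite mulr_gt0 ?sqrtr_gt0// ltr_pwDl// normr_ge0.
move=> f x; have [cf _] := curveP f.
have pf' : periodic1 (derive1 f) by apply: periodic1_derive1; exact: curve_periodic.
wlog /andP[x0 x1] : x / 0 <= x < 1.
  move=> H; have := H _ (floor_frac x).
  by rewrite -[in X in _ -> X](subrK (Num.floor x)%:~R x) periodic1_int.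
apply: norm_le_coord => [|i].
  by rewrite !mulr_ge0 ?sqrtr_ge0// addr_ge0// normr_ge0.
have cG : continuous (fun x => derive1 f x 0 i) by apply: continuous_coord; exact: cf.2.
have [sg [hsg h1 h2]] : exists sg : R, [/\ sg = 0 \/ sg = 1, sg / 2 <= x & x <= (sg + 1) / 2].
  have [h|h] := leP x (2^-1); [exists 0|exists 1].
    by split; [left|lra|lra].
  by split; [right|lra|lra].
have := derivative_bound (is_derive_coord i cf) cG s2 (sqr_ge0 `|f|)
  (coord_slob_le f i) hsg h1 h2.
move/le_trans; apply.
have E : Num.sqrt (2 * `|f| ^+ 2) = Num.sqrt 2 * `|f|.
  by rewrite sqrtrM// sqrtr_sqr ger0_norm.
have -> : Num.sqrt 2 * (1 + Q) * `|f| =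
    Num.sqrt (2 * `|f| ^+ 2) + Num.sqrt (2 * `|f| ^+ 2) * Q by rewrite E; ring.
apply: lerD; last by rewrite ler_wpM2l ?sqrtr_ge0// ler_norm.
rewrite /dyadic_quotient /dyadic expr1; apply: coord_H1_le.
  by case: hsg h1 h2 => -> *; lra.
by case: hsg h1 h2 => -> *; lra.
Qed.

(** * Smooth bumps in the Sobolev space *)

Section power_integral.
Context {R : realType}.
Notation mu := (@lebesgue_measure R).

Lemma continuous_powR (a x : R) : 0 < x -> {for x, continuous (fun w => w `^ a)}.
Proof.
move=> x0; apply: differentiable_continuous; apply/derivable1_diffP.
by apply: derivable_powR; rewrite in_itv/= x0.
Qed.

Lemma integral_powR_le (a d b : R) : - 1 < a -> 0 < d -> d < b ->
  (\int[mu]_(w in `[d, b]) (w `^ a)%:E <= (b `^ (a + 1) / (a + 1))%:E)%E.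
Proof.
move=> a1 d0 db; have a10 : 0 < a + 1 by lra.
pose F (w : R) := (a + 1)^-1 *: w `^ (a + 1).
have dF (x : R) : 0 < x -> derivable F x 1.
  by move=> x0; apply: derivableZ; apply: derivable_powR; rewrite in_itv/= x0.
have cF (x : R) : 0 < x -> {for x, continuous F}.
  by move=> x0; apply: differentiable_continuous; apply/derivable1_diffP/dF.
rewrite (@continuous_FTC2 _ _ F)//; last 3 first.
- apply: continuous_in_subspaceT => x /set_mem; rewrite /= in_itv/= => /andP[dx _].
  by apply: continuous_powR; lra.
- split.
  + by move=> x; rewrite in_itv/= => /andP[dx _]; apply: dF; lra.
  + by apply: cvg_at_right_filter; exact: cF.
  + by apply: cvg_at_left_filter; apply: cF; lra.
- move=> x; rewrite in_itv/= => /andP[dx _].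
  have x0 : 0 < x by lra.
  rewrite derive1E deriveZ; last by apply: derivable_powR; rewrite in_itv/= x0.
  have := @powR_derive1 R (a + 1) x; rewrite in_itv/= x0 derive1E => -> //.
  by rewrite /GRing.scale/= mulrA mulVf ?gt_eqF// mul1r addrK.
rewrite -EFinB lee_fin /F /GRing.scale/= -mulrBr [leLHS]mulrC ler_wpM2r ?invr_ge0 ?(ltW a10)//.
by rewrite gerBl powR_ge0.
Qed.

(** For negative [a] the integrand is singular at 0. The bound of [integral_powR_le] is uniform in
    the cut-off, so monotone convergence along the sets d_i <= |w| <= b carries it to the whole
    interval. *)
Lemma integral_norm_powR_le (a b : R) : - 1 < a -> 0 < b ->
  (\int[mu]_(w in `[(- b)%R, b]) (if w == 0%R then 0%R else `|w| `^ a)%:E <=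
    (2 * (b `^ (a + 1) / (a + 1)))%:E)%E.
Proof.
move=> a1 b0; pose h (w : R) := if w == 0 then 0 else `|w| `^ a.
have h0 w : 0 <= h w by rewrite /h; case: ifP => // _; exact: powR_ge0.
have mh : measurable_fun [set: R] (EFin \o h).
  apply/measurable_EFinP; apply: measurable_fun_ifT => //.
    exact: measurable_fun_eqr.
  exact: (measurableT_comp (measurable_powR _) (@normr_measurable _ _)).
(* Starting at b / 2 keeps each cut-off strictly below b, as [integral_powR_le] requires. *)
pose d (i : nat) : R := b / i.+2%:R.
have d0 i : 0 < d i by rewrite divr_gt0.
have db i : d i < b by rewrite ltr_pdivrMr// ltr_pMr// ltr1n.
pose S i : set R := `[- b, - d i] `|` `[d i, b].
have SP i w : S i w <-> d i <= `|w| <= b.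
  rewrite /S /= !in_itv/=; have := d0 i; have := db i; have [w0|w0] := ltP w 0.
    rewrite ltr0_norm//; split => [[/andP[? ?]|/andP[? ?]]|/andP[? ?]].
    - by apply/andP; split; lra.
    - by apply/andP; split; lra.
    - by left; apply/andP; split; lra.
  rewrite ger0_norm//; split => [[/andP[? ?]|//]|]; last by right.
  by apply/andP; split; lra.
have SU : \bigcup_i S i = `[- b, b] `\ 0.
  apply/seteqP; split => w.
    move=> [i _ /SP /andP[w1 w2]]; split.
      by rewrite /= in_itv/= -ler_norml.
    by move=> w0; move: w1 (d0 i); rewrite w0 normr0; lra.
  move=> [/= + /eqP w0]; rewrite in_itv/= -ler_norml => wb.
  have wn : 0 < `|w| by rewrite normr_gt0.
  have [k hk] : exists k, d k <= `|w|.
    pose k := Num.truncn (b / `|w|); exists k.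
    rewrite ler_pdivrMr// mulrC -ler_pdivrMr//.
    apply: ltW; apply: lt_le_trans (truncnS_gt _) _.
    by rewrite ler_nat.
  by exists k => //; apply/SP; rewrite hk.
have -> : (\int[mu]_(w in `[(- b)%R, b]) (h w)%:E = \int[mu]_(w in \bigcup_i S i) (h w)%:E)%E.
  rewrite SU integral_mkcond [RHS]integral_mkcond; apply: eq_integral => w _.
  rewrite !patchE; have [->|w0] := eqVneq w 0.
    by rewrite /h eqxx !if_same.
  congr (if _ then _ else _); apply/idP/idP => /set_mem H; apply/mem_set; last by case: H.
  by split => // /eqP; rewrite (negbTE w0).
have mS i : measurable (S i) by apply: measurableU.
have ndS : nondecreasing_seq S.
  move=> i j ij; apply/subsetPset => w /SP /andP[w1 w2]; apply/SP.
  rewrite w2 andbT; apply: le_trans w1.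
  by rewrite ler_pM2l// lef_pV2 ?posrE// ler_nat.
have cv := @ge0_nondecreasing_set_cvg_integral _ (measurableTypeR R) R S
  (EFin \o h) mu ndS mS (fun i => measurable_funS measurableT (@subsetT _ _) mh)
  (fun i x _ => (h0 x : (0 <= (h x)%:E)%E)).
rewrite -(cvg_lim _ cv)//; apply: lime_le; first by apply/cvg_ex; eexists; exact: cv.
apply: nearW => i; rewrite ge0_integral_setU//=; last 3 first.
- exact: measurable_funS mh.
- by move=> x _; rewrite lee_fin.
- apply/disj_setPS => x [] /=; rewrite !in_itv/= => /andP[_ ?] /andP[? _].
  by have := d0 i; lra.
have E : (\int[mu]_(w in `[d i, b]) (w `^ a)%:E <= (b `^ (a + 1) / (a + 1))%:E)%E.
  exact: integral_powR_le a1 (d0 i) (db i).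
rewrite mulr_natl mulr2n EFinD; apply: leeD; last first.
  apply: le_trans E; apply: ge0_le_integral_nonmeasurable => x; rewrite lee_fin//.
  rewrite /= in_itv/= => /andP[dx _].
  have x0 : 0 < x by apply: lt_le_trans dx.
  by rewrite /h gt_eqF// ger0_norm// ltW.
apply: le_trans E.
apply: (@le_trans _ _ (\int[mu]_(w in `[(- b)%R, (- d i)%R]) ((- w) `^ a)%:E)%E).
  apply: ge0_le_integral_nonmeasurable => x; rewrite lee_fin//.
  rewrite /= in_itv/= => /andP[_ dx].
  have x0 : x < 0 by have := d0 i; lra.
  by rewrite /h lt_eqF// ltr0_norm.
rewrite (@integration_by_substitution_oppr _ (fun w => (- w) `^ a)); last 2 first.
- exact: ltW.
- apply: continuous_in_subspaceT => x /set_mem; rewrite /= in_itv/= => /andP[_ dx].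
  apply: (@continuous_comp _ _ _ -%R (fun w => w `^ a)).
    exact: opp_continuous.
  by apply: continuous_powR; have := d0 i; lra.
by apply: ge0_le_integral_nonmeasurable => // x _ /=; rewrite ?lee_fin ?opprK ?powR_ge0.
Qed.

End power_integral.

Lemma derive_bounded_lipschitz (R : realType) (f df : R -> R) (l : R) :
  (forall x, is_derive x (1 : R) f (df x)) -> (forall x, `|df x| <= l) ->
  forall x y, `|f y - f x| <= l * `|y - x|.
Proof.
move=> dF dl x y; wlog xy : x y / x <= y.
  move=> H; have [|/ltW] := leP x y; first exact: H.
  by rewrite distrC (distrC y); exact: H.
have cf : {within `[x, y], continuous f}.
  apply: continuous_subspaceT => z; apply: differentiable_continuous.
  by apply/derivable1_diffP; case: (dF z).
have [c _ ->] := MVT_segment xy (fun z _ => dF z) cf.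
by rewrite normrM ler_wpM2r.
Qed.

Section bump.
Context {R : realType}.
Variables a b : R.
Let sb x := sin (pi * (x - b)) : R.
Let cb x := cos (pi * (x - b)) : R.
Let sa x := sin (pi * (x - a)) : R.
Let ca x := cos (pi * (x - a)) : R.

(** A trigonometric polynomial: the squared sine has a double zero at b, and sin cos = sin(2 pi (x -
    a)) / 2 has a simple zero at a. Each of the two factors has period 1, while a lone sine of pi (x
    - a) would change sign. *)
Definition bump x := sb x * sb x * (sa x * ca x).
Definition bump' x :=
  pi * (2 * (sb x * cb x * sa x * ca x) + sb x * sb x * (ca x * ca x - sa x * sa x)).
Let bump'' x :=
  pi * (pi * (2 * (cb x * cb x - sb x * sb x) * (sa x * ca x)
    + 4 * (sb x * cb x) * (ca x * ca x - sa x * sa x)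
    - 4 * (sb x * sb x) * (sa x * ca x))).

Let dlin (e x : R) : is_derive x (1 : R) (fun x => pi * (x - e)) pi.
Proof. by apply: is_derive_eq; rewrite /GRing.scale/=; ring. Qed.

Let dsin (e x : R) : is_derive x (1 : R) (fun x => sin (pi * (x - e)))
  (pi * cos (pi * (x - e))).
Proof.
have := @is_derive1_comp R sin (fun x => pi * (x - e)) x _ _ (is_derive_sin _) (dlin e x).
by rewrite mulrC.
Qed.

Let dcos (e x : R) : is_derive x (1 : R) (fun x => cos (pi * (x - e)))
  (- (pi * sin (pi * (x - e)))).
Proof.
have := @is_derive1_comp R cos (fun x => pi * (x - e)) x _ _ (is_derive_cos _) (dlin e x).
by rewrite mulNr mulrC.
Qed.

Let dsb x : is_derive x (1 : R) sb (pi * cb x). Proof. exact: dsin. Qed.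
Let dsa x : is_derive x (1 : R) sa (pi * ca x). Proof. exact: dsin. Qed.
Let dcb x : is_derive x (1 : R) cb (- (pi * sb x)). Proof. exact: dcos. Qed.
Let dca x : is_derive x (1 : R) ca (- (pi * sa x)). Proof. exact: dcos. Qed.

Lemma is_derive_bump x : is_derive x (1 : R) bump (bump' x).
Proof.
have h1 := dsb x; have h2 := dsa x; have h3 := dca x.
by apply: is_derive_eq; rewrite /bump' /GRing.scale/=; ring.
Qed.

Let is_derive_bump' x : is_derive x (1 : R) bump' (bump'' x).
Proof.
have h1 := dsb x; have h2 := dsa x; have h3 := dca x; have h4 := dcb x.
by apply: is_derive_eq; rewrite /bump'' /GRing.scale/=; ring.
Qed.

Lemma bump'_continuous : continuous bump'.
Proof.
move=> x; apply: differentiable_continuous; apply/derivable1_diffP.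
by case: (is_derive_bump' x).
Qed.

Let shift1 (e x : R) : pi * (x + 1 - e) = pi * (x - e) + pi.
Proof. by ring. Qed.

Lemma bump_periodic : periodic1 bump.
Proof. by move=> x; rewrite /bump /sb /sa /ca !shift1 !sinDpi !cosDpi !mulrNN. Qed.

Lemma bump0 : bump a = 0 /\ bump b = 0.
Proof. by rewrite /bump /sb /sa !subrr !mulr0 sin0 !mul0r mulr0. Qed.

Lemma bump'_r : bump' b = 0.
Proof. by rewrite /bump' /sb subrr mulr0 sin0 !mul0r !mulr0 addr0 mulr0. Qed.

Lemma bump'_l : 0 <= a < 1 -> 0 <= b < 1 -> a != b -> bump' a != 0.
Proof.
move=> /andP[a0 a1] /andP[b0 b1] ab.
have sne : sb a != 0.
  have [h|h|h] := ltgtP a b; last by rewrite h eqxx in ab.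
    rewrite /sb -opprB mulrN sinN oppr_eq0 gt_eqF// sin_gt0_pi//.
    by rewrite mulr_gt0 ?pi_gt0 ?subr_gt0//= gtr_pMr ?pi_gt0//; lra.
  rewrite /sb gt_eqF// sin_gt0_pi//.
  by rewrite mulr_gt0 ?pi_gt0 ?subr_gt0//= gtr_pMr ?pi_gt0//; lra.
rewrite /bump' /sa /ca subrr mulr0 sin0 cos0 !(mulr0, mul0r) add0r subr0 !mulr1.
by rewrite !mulf_neq0// gt_eqF// pi_gt0.
Qed.

Lemma bump'_lipschitz : exists2 l, 0 <= l & forall x y, `|bump' y - bump' x| <= l * `|y - x|.
Proof.
(* The three terms of [bump''] contribute 2 * 2, 4 * 2 and 4 * 1. *)
exists (16 * (pi * pi)); first by rewrite !mulr_ge0 ?pi_ge0.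
apply: derive_bounded_lipschitz is_derive_bump' _ => x.
rewrite /bump'' !normrM (ger0_norm (pi_ge0 R)).
rewrite [leRHS]mulrC -[leRHS]mulrA !ler_wpM2l ?pi_ge0//.
have M (u v : R) : `|u| <= 1 -> `|v| <= 1 -> `|u * v| <= 1.
  by move=> h1 h2; rewrite normrM mulr_ile1.
have h1 := M _ _ (sin_max (pi * (x - b))) (sin_max (pi * (x - b))).
have h2 := M _ _ (cos_max (pi * (x - b))) (cos_max (pi * (x - b))).
have h3 := M _ _ (sin_max (pi * (x - b))) (cos_max (pi * (x - b))).
have h4 := M _ _ (sin_max (pi * (x - a))) (sin_max (pi * (x - a))).
have h5 := M _ _ (cos_max (pi * (x - a))) (cos_max (pi * (x - a))).
have h6 := M _ _ (sin_max (pi * (x - a))) (cos_max (pi * (x - a))).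
have h7 : `|(cb x * cb x - sb x * sb x) * (sa x * ca x)| <= 2.
  rewrite normrM -[leRHS]mulr1 ler_pM//.
  by apply: le_trans (ler_normB _ _) _; rewrite -[2]/(1 + 1) lerD.
have h8 : `|(sb x * cb x) * (ca x * ca x - sa x * sa x)| <= 2.
  rewrite normrM -[leRHS]mul1r ler_pM//.
  by apply: le_trans (ler_normB _ _) _; rewrite -[2]/(1 + 1) lerD.
have h9 : `|sb x * sb x * (sa x * ca x)| <= 1 by apply: M.
rewrite -(mulrA 2) -(mulrA 4 (sb x * cb x)) -(mulrA 4 (sb x * sb x)).
move: h7 h8 h9; move: ((_ - _) * _) (_ * (_ - _)) (_ * _ * (_ * _)) => X Y Z.
rewrite !ler_norml => /andP[? ?] /andP[? ?] /andP[? ?].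
by apply/andP; split; lra.
Qed.
End bump.

Section lipschitz_derivative.
Context {R : realType} {n : nat}.
Notation mu := (@lebesgue_measure R).
Notation T2 := (measurableTypeR R * measurableTypeR R)%type.

(** The integrand of the seminorm is at most l^2 |w|^(1 - 2 s), and s < 1 makes this integrable at
    0. *)
Lemma lipschitz_derive1_sobolev (f : R -> 'rV[R]_n) (s l : R) :
  0 < s < 1 -> C1 f -> periodic1 f ->
  (forall u w, enorm (derive1 f (u + w) - derive1 f u) <= l * `|w|) ->
  f \in sobolev_curves s.
Proof.
move=> /andP[s0 s1] cf pf lf; apply/asboolP; split => //; split.
- by apply: C1_L2 => //; exact: C1_continuous.
- by apply: C1_L2; [exact: periodic1_derive1|exact: cf.2].
- exact: C1_weak_derivative.
pose a := 1 - 2 * s.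
pose h (w : R) : R := if w == 0 then 0 else `|w| `^ a.
have h0 w : 0 <= h w by rewrite /h; case: ifP => // _; exact: powR_ge0.
have mh : measurable_fun [set: measurableTypeR R] h.
  apply: measurable_fun_ifT => //.
    exact: measurable_fun_eqr.
  exact: (measurableT_comp (measurable_powR _) (@normr_measurable _ _)).
apply: (@le_lt_trans _ _ (\int[mu \x mu]_(z in slob_dom) (l ^+ 2 * h z.2)%:E)%E).
  apply: ge0_le_integral_nonmeasurable => -[u w] _ /=.
    by rewrite lee_fin mulr_ge0 ?sqr_ge0// powR_ge0.
  rewrite lee_fin /increment /slob_kernel /h /=.
  have := lf u w; have [->|w0] := eqVneq w 0.
    rewrite normr0 !mulr0 => H.
    by rewrite (_ : enorm _ = 0) ?expr0n ?mul0r//; apply/eqP; rewrite eq_le H enorm_ge0.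
  move=> H; have w1 : 0 < `|w| by rewrite normr_gt0.
  have -> : `|w| `^ a = `|w| ^+ 2 * `|w| `^ (-1 - 2 * s).
    rewrite -powR_mulrn// -powRD; last by apply/implyP => _; rewrite gt_eqF.
    by congr (_ `^ _); rewrite /a; ring.
  rewrite mulrA ler_wpM2r ?powR_ge0// -exprMn.
  by rewrite ler_sqr ?nnegrE ?enorm_ge0// (le_trans (enorm_ge0 _) H).
rewrite slob_dom_fubini; last 2 first.
- by apply: measurable_funM => //; exact: (measurableT_comp mh measurable_snd).
- by move=> z; rewrite mulr_ge0 ?sqr_ge0.
have a1 : - 1 < a by rewrite /a; lra.
pose C := l ^+ 2 * (2 * (2^-1 `^ (a + 1) / (a + 1))).
have half0 : 0 < 2^-1 :> R by rewrite invr_gt0.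
apply: (@le_lt_trans _ _ (\int[mu]_(u in `[0%R, 1%R]) C%:E)%E); last first.
  by rewrite integral_cst//= lebesgue_measure_itv /= lte_fin ltr01 -EFinB -EFinM ltry.
apply: ge0_le_integral_nonmeasurable => u _.
  by apply: integral_ge0 => w _; rewrite lee_fin mulr_ge0 ?sqr_ge0.
under eq_integral do rewrite EFinM.
rewrite ge0_integralZl//=; last 3 first.
- by apply/measurable_EFinP; exact: measurable_funTS.
- by move=> x _; rewrite lee_fin.
- by rewrite lee_fin sqr_ge0.
rewrite (_ : C%:E = (l ^+ 2)%:E * (2 * (2^-1 `^ (a + 1) / (a + 1)))%:E)%E; last first.
  by rewrite -EFinM.
by apply: lee_wpmul2l; rewrite ?lee_fin ?sqr_ge0//; exact: integral_norm_powR_le.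
Qed.

End lipschitz_derivative.

Lemma is_derive_scale_cst (R : realType) (n : nat) (f : R -> R) (w : 'rV[R]_n)
    (x d : R) :
  is_derive x (1 : R) f d -> is_derive x (1 : R) (fun x => f x *: w) (d *: w).
Proof.
move=> df; have dj j : is_derive x (1 : R) (fun y => (f y *: w) 0 j) (d * w 0 j).
  rewrite (_ : (fun y => _) = (fun y => f y * w 0 j)); last first.
    by apply/funext => y; rewrite mxE.
  by apply: is_derive_eq; rewrite /GRing.scale/=; ring.
have dmx : derivable (fun x => f x *: w) x 1.
  by apply/derivable_mxP => i j; rewrite ord1; case: (dj j).
apply: DeriveDef => //; rewrite derive_mx//.
by apply/rowP => j; rewrite !mxE; case: (dj j).
Qed.

Section bump_curve.
Context {R : realType} {n : nat}.
Variables (a b s : R) (w : 'rV[R]_n).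

Let f x := bump a b x *: w.

Lemma derive1_bump_curve : derive1 f = fun x => bump' a b x *: w.
Proof.
apply/funext => x; rewrite derive1E.
by case: (is_derive_scale_cst w (is_derive_bump a b x)).
Qed.

Lemma bump_curve_sobolev : 0 < s < 1 -> f \in sobolev_curves s.
Proof.
move=> hs; have [l l0 hl] := @bump'_lipschitz R a b.
apply: (@lipschitz_derive1_sobolev _ _ _ _ (l * enorm w)) => //.
- split.
    by move=> x; case: (is_derive_scale_cst w (is_derive_bump a b x)).
  rewrite derive1_bump_curve => x; apply: cvgZr_tmp.
  exact: bump'_continuous.
- by move=> x; rewrite /f bump_periodic.
- move=> u v; rewrite derive1_bump_curve -scalerBl.
  have -> (t : R) : enorm (t *: w) = `|t| * enorm w.
    rewrite /enorm dotZl dotC dotZl mulrA -expr2 sqrtrM ?sqr_ge0//.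
    by rewrite sqrtr_sqr.
  rewrite mulrAC ler_wpM2r ?enorm_ge0//.
  by have := hl u (u + v); rewrite addrAC subrr add0r.
Qed.

End bump_curve.

(** * Finite energy near a regular curve excludes double points *)

Lemma normr_subDr (R : realType) (V : normedModType R) (x y : V) :
  `|x - (y + x)| = `|y|.
Proof. by rewrite (addrC y) opprD addrA subrr sub0r normrN. Qed.

Lemma regular_coord (R : realType) (n : nat) (c : R -> 'rV[R]_n) (u : R) :
  regular c -> exists i, derive1 c u 0 i != 0.
Proof.
move=> rc; apply: contrapT => /forallNP H.
have := rc u; rewrite (_ : derive1 c u = 0) ?enorm0 ?ltxx//.
by apply/rowP => j; rewrite mxE; apply/eqP; apply: contrapT => /negP /H.
Qed.

(** In dimension one, Rolle's theorem would give a closed curve a critical point. A second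
    coordinate provides a direction for the perturbation. *)
Lemma two_coordinates (R : realType) (n : nat) (c : R -> 'rV[R]_n) (i : 'I_n) :
  C1 c -> periodic1 c -> regular c -> exists j : 'I_n, j != i.
Proof.
move=> cc pc rc; apply: contrapT => /forallNP H.
have {}H (j : 'I_n) : j = i by apply/eqP; apply: contrapT => /negP /H.
have c01 : c 0 0 i = c 1 0 i by rewrite -[1]add0r pc.
have [x _ [_ dx]] : exists2 x : R, x \in `]0, 1[%R & is_derive x (1 : R) (fun y => c y 0 i) 0.
  apply: Rolle => //.
    by move=> x _; case: (is_derive_coord i cc x).
  by apply: continuous_subspaceT; apply: continuous_coord; exact: C1_continuous.
have := rc x; rewrite (_ : derive1 c x = 0) ?enorm0 ?ltxx//.
apply/rowP => j; rewrite (H j) mxE -dx.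
by case: (is_derive_coord i cc x).
Qed.

Lemma embedded_of_finite_energy_near (R : realType) (n : nat) (p : R)
    (c : menger_space n p) : 7 / 3 < p < 8 / 3 -> regular c ->
  (\forall c' \near c, intM p (curve_fun c') \is a fin_num) -> embedded c.
Proof.
move=> /andP[p1 p2] rc; have [cc _] := curveP c; have pc := curve_periodic c.
move=> /nbhs_ballP[e /= e0 he] a b; rewrite !inE /= !in_itv/= => ha hb cab.
apply/eqP; apply: contrapT => /negP ab.
have hs : 0 < 3 / 2 * p - 3 < 1 by apply/andP; split; lra.
have [i Bi] := regular_coord b rc.
have [j ji] := two_coordinates i cc pc rc.
pose w : 'rV[R]_n := delta_mx 0 j.
pose phi : menger_space n p := SobolevCurve (bump_curve_sobolev a b w hs).
(* Adding [d *: phi] leaves the derivative at b unchanged and adds d * bump' a b a to coordinate j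
   of the derivative at a. The minor (i, j) therefore moves by a nonzero multiple of d: if it
   vanishes, any small d > 0 makes it nonzero, and otherwise d = 0 serves. *)
have [d [dphi dn]] : exists d, `|d *: phi| < e /\
    derive1 c a 0 i * derive1 c b 0 j - derive1 c a 0 j * derive1 c b 0 i
      - d * bump' a b a * derive1 c b 0 i != 0.
  move: (_ * _ - _ * _) => X; set k := bump' a b a * derive1 c b 0 i.
  have k0 : k != 0 by rewrite mulf_neq0// bump'_l.
  have [X0|X0] := eqVneq X 0; last first.
    by exists 0; rewrite scale0r normr0 !mul0r subr0; split; [exact: e0|exact: X0].
  have P0 : 0 < `|phi| + 1 by rewrite ltr_wpDl.
  exists (e / (`|phi| + 1)); split.
    rewrite normrZ ger0_norm ?divr_ge0 ?(ltW e0) ?(ltW P0)//.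
    by rewrite mulrAC ltr_pdivrMr// ltr_pM2l// ltrDl.
  by rewrite X0 sub0r oppr_eq0 -mulrA mulf_neq0// gt_eqF// divr_gt0.
have /he : ball c e (d *: phi + c).
  by rewrite -ball_normE /= normr_subDr.
apply/negP; apply: (intM_transversal (i := i) (j := j) p1 _ ha hb).
- by have [] := curveP (d *: phi + c).
- have E x : curve_fun (d *: phi + c) x = d *: (bump a b x *: w) + c x by [].
  by rewrite !E (bump0 a b).1 (bump0 a b).2 cab.
have cphi : C1 phi by have [] := curveP phi.
have E x : derive1 (d *: phi + c) x = d *: (bump' a b x *: w) + derive1 c x.
  rewrite (_ : curve_fun (d *: phi + c) = d *: curve_fun phi + curve_fun c)//.
  rewrite derive1_lin//= -[LHS]/(d *: derive1 phi x + derive1 c x).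
  by congr (_ *: _ + _); rewrite derive1_bump_curve.
rewrite !E bump'_r scale0r scaler0 add0r !mxE /= !eqxx (eq_sym i) (negbTE ji) /=.
rewrite mulr1 !mulr0 add0r -subr_eq0.
move: (derive1 c a 0 i) (derive1 c a 0 j) (derive1 c b 0 i) (derive1 c b 0 j) dn.
by move: (bump' a b a) => k A1 A2 B1 B2; rewrite mulrDl opprD addrA addrAC.
Qed.

(** * Conservation of the speed along the flow *)

Lemma linear_formB (R : realType) (V : lmodType R) (E : V -> R) :
  (forall a x y, E (a *: x + y) = a * E x + E y) ->
  (forall x y, E (x - y) = E x - E y) /\ (forall x, E (- x) = - E x).
Proof.
move=> lE; have E0 : E 0 = 0 by have := lE 1 0 0; rewrite scaler0 addr0; lra.
have EN x : E (- x) = - E x.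
  by have := lE (-1) x 0; rewrite scaleN1r addr0 E0 addr0 mulN1r.
by split => // x y; have := lE 1 x (- y); rewrite scale1r mul1r EN.
Qed.

(** Applied to the functional that sends a curve to a coordinate of its derivative at a fixed u,
    bounded on H by the embedding into C^1; it exchanges the derivatives in t and in u. *)
Lemma is_derive_bounded_linear (R : realType) (V : normedModType R) (E : V -> R)
    (k : R) (g : R -> V) (t : R) (v : V) :
  (forall a x y, E (a *: x + y) = a * E x + E y) -> (forall x, `|E x| <= k * `|x|) ->
  is_derive t (1 : R) g v -> is_derive t (1 : R) (E \o g) (E v).
Proof.
move=> lE bE [dg gv].
have E0 : E 0 = 0 by have := lE 1 0 0; rewrite scaler0 addr0; lra.
have [EB _] := linear_formB lE.
have EZ a x : E (a *: x) = a * E x by rewrite -[a *: x]addr0 lE E0 addr0.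
have cE : continuous E.
  move=> x; apply/cvgrPdist_lt => e e0.
  have k0 : 0 < `|k| + 1 by rewrite ltr_wpDl.
  near=> y; rewrite -EB; apply: le_lt_trans (bE _) _.
  apply: (@le_lt_trans _ _ ((`|k| + 1) * `|x - y|)).
    by rewrite ler_wpM2r// (le_trans (ler_norm _))// lerDl.
  rewrite mulrC -ltr_pdivlMr//.
  by near: y; apply: cvgr_dist_lt => //; rewrite divr_gt0.
have qE : (fun h : R => h^-1 *: (((E \o g) \o shift t) (h *: 1) - (E \o g) t)) =
    E \o (fun h : R => h^-1 *: ((g \o shift t) (h *: 1) - g t)).
  by apply/funext => h /=; rewrite EZ EB.
have cv : (fun h : R => h^-1 *: (((E \o g) \o shift t) (h *: 1) - (E \o g) t)) @ 0^' --> E v.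
  rewrite qE; apply: (cvg_comp _ E _ (cE v)).
  by rewrite -gv; exact: dg.
by apply: DeriveDef; [apply/cvg_ex; exists (E v)|apply: cvg_lim cv].
Unshelve. all: by end_near. Qed.

Section flow_regularity.
Context {R : realType} {n : nat} {p : R}.
Notation H := (menger_space n p).
Hypothesis hp : 7 / 3 < p < 8 / 3.

Lemma menger_derive1_le :
  exists2 K, 0 < K & forall (f : H) x, `|derive1 f x| <= K * `|f|.
Proof. by apply: sobolev_derive1_le; move: hp => /andP[? ?]; lra. Qed.

(** Serves all t >= 0 at once, including t = 0, where only a one-sided derivative is given. *)
Lemma C1_halfline_lipschitz (g : R -> H) t : C1_halfline g -> 0 <= t ->
  exists2 d, 0 < d & exists2 L, 0 < L &
    forall x, 0 <= x -> `|x - t| < d -> `|g x - g t| <= L * `|x - t|.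
Proof.
move=> [dg [hg _]] t0.
have /cvgrPdist_le/(_ _ ltr01) := hg t t0.
move=> /nbhs_ballP[d /= d0 hd]; exists d => //.
exists (`|dg t| + 1); first by rewrite ltr_wpDl.
move=> x x0 xd; have [->|xt] := eqVneq x t.
  by rewrite !subrr normr0 normr0 mulr0.
have := hd x; rewrite /ball /= distrC => /(_ xd xt).
rewrite in_itv/= x0 => /(_ isT) h.
have xt0 : x - t != 0 by rewrite subr_eq0.
rewrite -[g x - g t](scalerKV xt0) normrZ mulrC ler_wpM2r//.
rewrite -lerBlDl; apply: le_trans h.
by rewrite distrC; exact: lerB_dist.
Qed.

Lemma derive1_curve_lin (a : R) (f g : H) u i :
  derive1 (a *: f + g) u 0 i = a * derive1 f u 0 i + derive1 g u 0 i.
Proof.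
have [cf _] := curveP f; have [cg _] := curveP g.
rewrite (_ : curve_fun (a *: f + g) = a *: curve_fun f + curve_fun g)//.
rewrite derive1_lin//; transitivity ((a *: derive1 f u + derive1 g u) 0 i) => //.
by rewrite !mxE.
Qed.

(** Where the derivative of [c] vanishes, the quotient in [DSigma] is 0 by convention, but so is the
    dot product. Conservation of the speed can thus be proved first, and regularity deduced from
    it. *)
Lemma DSigma_dot (c v : H) u : DSigma c v = cst 0 ->
  dot (derive1 c u) (derive1 v u) = 0.
Proof.
move=> /(congr1 (fun f => f u)); rewrite /DSigma /=.
move: (derive1 c u) (derive1 v u) => A B /eqP; rewrite mulf_eq0 => /orP[/eqP//|].
rewrite invr_eq0 enorm2 => /eqP /dot_eq0 ->.
by rewrite /dot big1// => i _; rewrite mxE mul0r.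
Qed.

(** At fixed u the squared speed has t-derivative -2 times the dot product of the derivatives of
    [g t] and of the projected gradient [v], which is 0 because [v] lies in the null space. The mean
    value theorem on [0, t] also needs continuity at the endpoint 0. *)
Lemma flow_speed (g0 : H) (g : R -> H) u t : is_projected_flow g0 g -> 0 <= t ->
  dot (derive1 (g t) u) (derive1 (g t) u) = dot (derive1 g0 u) (derive1 g0 u).
Proof.
move=> [C1g g00 fg] t0; have [K K0 hK] := menger_derive1_le.
pose q i (t : R) := derive1 (g t) u 0 i.
pose N := \sum_i (fun t => q i t * q i t).
have NE x : dot (derive1 (g x) u) (derive1 (g x) u) = N x.
  by rewrite /N fct_sumE.
rewrite NE -g00 NE.
have [->//|tn0] := eqVneq t 0.
have tp : 0 < t by rewrite lt_def tn0.
have cq i : {within `[0, t], continuous (q i)}.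
  apply/subspace_continuousP => x; rewrite /= in_itv/= => /andP[x0 _].
  have [d d0 [L L0 hL]] := C1_halfline_lipschitz C1g x0.
  apply/cvgrPdist_lt => e e0; apply/nbhs_ballP.
  exists (Num.min d (e / (K * L))); first by rewrite /= lt_min d0 divr_gt0// mulr_gt0.
  move=> y; rewrite /ball /= lt_min distrC => /andP[yd ye].
  rewrite in_itv/= => /andP[y0 _].
  rewrite /q; have <- : derive1 (g x - g y) u 0 i = derive1 (g x) u 0 i - derive1 (g y) u 0 i.
    exact: (linear_formB (fun a f h => derive1_curve_lin a f h u i)).1.
  apply: le_lt_trans (ler_coord_norm _ _) _; apply: le_lt_trans (hK _ _) _.
  rewrite distrC; apply: (@le_lt_trans _ _ (K * (L * `|y - x|))).
    by rewrite ler_pM2l//; exact: hL.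
  by rewrite mulrA mulrC -ltr_pdivlMr// mulr_gt0.
have dN x : x \in `]0, t[%R -> is_derive x (1 : R) N 0.
  rewrite in_itv/= => /andP[x0 _].
  have [v [gr _ [nv _]] dv] := fg x x0.
  have dq i : is_derive x (1 : R) (q i) (- derive1 v u 0 i).
    have bE (f : H) : `|derive1 f u 0 i| <= K * `|f|.
      by apply: le_trans (hK f u); exact: ler_coord_norm.
    have := is_derive_bounded_linear (fun a f h => derive1_curve_lin a f h u i) bE dv.
    by rewrite (linear_formB (fun a f h => derive1_curve_lin a f h u i)).2.
  suff -> : 0 = \sum_i (q i x *: - derive1 v u 0 i + q i x *: - derive1 v u 0 i).
    by apply: is_derive_sum => i; exact: is_deriveM.
  rewrite big_split /=; apply: esym; apply/eqP; rewrite -mulr2n mulrn_eq0 /=.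
  have := DSigma_dot u nv; rewrite /dot => h.
  by under eq_bigr do rewrite /GRing.scale/= mulrN; rewrite sumrN h oppr0.
have cN : {within `[0, t], continuous N}.
  apply/subspace_continuousP => x Ax; rewrite /N fct_sumE.
  apply: cvg_big => [|i _]; first exact: add_continuous.
  by have /subspace_continuousP /(_ x Ax) h := cq i; apply: cvgM.
have [c _] := MVT_segment t0 dN cN.
by rewrite mul0r => /eqP; rewrite subr_eq0 => /eqP.
Qed.

Lemma flow_regular (g0 : H) (g : R -> H) t : is_projected_flow g0 g ->
  regular g0 -> 0 <= t -> regular (g t).
Proof. by move=> fg rg t0 u; rewrite /enorm (flow_speed u fg t0); exact: rg. Qed.

End flow_regularity.

(** * Ambient isotopy of nearby curves *)

Section bilipschitz.
Context {R : realType} {n : nat}.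
Implicit Types c : R -> 'rV[R]_n.

(** Parameters with the same image differ by an integer, and 0 is the only integer of absolute value
    at most 1/2. *)
Lemma embedded_increment c u w : periodic1 c -> embedded c ->
  `|w| <= 2^-1 -> c (u + w) = c u -> w = 0.
Proof.
move=> pc ec w2 cuw.
have frac x : c (x - (Num.floor x)%:~R) = c x by rewrite -mulrNz periodic1_int.
have H : u + w - (Num.floor (u + w))%:~R = u - (Num.floor u)%:~R.
  apply: ec; rewrite ?inE /= ?in_itv/= ?floor_frac//.
  by rewrite !frac.
have wk : w = (Num.floor (u + w) - Num.floor u)%:~R by rewrite intrB; lra.
move: w2; rewrite wk -intr_norm => h.
have {h} : `|Num.floor (u + w) - Num.floor u| < 1.
  by rewrite -(ltr_int R); apply: le_lt_trans h _; lra.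
move: (_ - _) => k hk; suff -> : k = 0 by [].
apply/eqP; rewrite -normr_le0 -ltzD1 add0r; exact: hk.
Qed.

(** By compactness it suffices to find, near each pair (u, w), a bound valid for all small m > 0. At
    w = 0 both sides vanish, and the mean value theorem is applied to one coordinate whose
    derivative is nonzero at u. At w != 0 embeddedness keeps the right-hand side away from 0, while
    |w| stays below 1. *)
Lemma embedded_bilipschitz c : C1 c -> periodic1 c -> regular c -> embedded c ->
  exists2 m, 0 < m & forall u w, `|w| <= 2^-1 -> m * `|w| <= `|c (u + w) - c u|.
Proof.
move=> cc pc rc ec.
pose K : set (R * R) := `[0, 1] `*` `[- 2^-1, 2^-1].
have cK : compact K by apply: compact_setX; exact: segment_compact.
pose P (m : R) (z : R * R) := m * `|z.2| <= `|c (z.1 + z.2) - c z.1|.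
have cov : \forall m \near (0 : R)^'+, K `<=` P m.
  move/compact_near_coveringP : cK; apply => -[u w] /= [_ hw].
  have {}hw : `|w| <= 2^-1 by move: hw; rewrite /= in_itv/= ler_norml.
  have [w0|w0] := eqVneq w 0.
    rewrite {}w0 {hw w}.
    have [i hi] := regular_coord u rc.
    set k := `|derive1 c u 0 i|; have k0 : 0 < k by rewrite normr_gt0.
    have cci : {for u, continuous (fun x => derive1 c x 0 i)}.
      by apply: continuous_coord; exact: cc.2.
    have [d d0 hd] : exists2 d, 0 < d & forall x, `|x - u| < d -> k / 2 <= `|derive1 c x 0 i|.
      have /cvgrPdist_le/(_ (k / 2)) := cci; rewrite divr_gt0// => /(_ isT).
      move=> /nbhs_ballP[d /= d0 hd]; exists d => // x xd.
      have := hd x; rewrite /ball /= distrC => /(_ xd) h.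
      have := lerB_dist (derive1 c u 0 i) (derive1 c x 0 i); rewrite -/k; lra.
    exists (ball (u, 0) (d / 2), [set m | 0 < m <= k / 2]).
      split; first by apply: nbhsx_ballx; rewrite divr_gt0.
      near=> m; apply/andP; split; near: m; first exact: nbhs_right_gt.
      by apply: nbhs_right_le; rewrite divr_gt0.
    move=> [[v w] m] /= [[/= hv hw] /andP[m0 m1]].
    rewrite /P /=; apply: le_trans (ler_coord_norm _ i); rewrite !mxE.
    move: hv hw; rewrite /ball /= sub0r normrN => hv hw.
    have dci := is_derive_coord i cc.
    have cci' : continuous (fun y => c y 0 i) by apply: continuous_coord; exact: C1_continuous.
    have key (x y : R) : `|x - u| < d -> `|y - u| < d -> x <= y ->
        m * (y - x) <= `|c y 0 i - c x 0 i|.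
      move=> xu yu xy.
      have [z + ->] := MVT_segment xy (fun z _ => dci z) (continuous_subspaceT cci').
      rewrite in_itv/= => /andP[z0 z1].
      rewrite normrM (ger0_norm (_ : 0 <= y - x)) ?subr_ge0// ler_wpM2r ?subr_ge0//.
      apply: le_trans m1 (hd _ _); move: xu yu; rewrite !ltr_norml => /andP[? ?] /andP[? ?].
      by apply/andP; split; lra.
    have vu : `|v - u| < d by rewrite distrC; lra.
    have vwu : `|v + w - u| < d.
      by move: hv hw; rewrite !ltr_norml => /andP[? ?] /andP[? ?]; apply/andP; split; lra.
    have [w0|w0] := leP 0 w.
      have := key v (v + w) vu vwu; rewrite lerDl w0 [v + w - v]addrAC subrr add0r.
      by move=> /(_ isT); rewrite (ger0_norm w0).
    have := key (v + w) v vwu vu; rewrite gerDl (ltW w0) => /(_ isT).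
    by rewrite [- (v + w)]opprD [v + (- v - w)]addrA subrr sub0r distrC (ltr0_norm w0).
  have cn : c (u + w) - c u != 0.
    by rewrite subr_eq0; apply: contra w0 => /eqP h; apply/eqP; exact: embedded_increment h.
  set e := `|c (u + w) - c u|; have e0 : 0 < e by rewrite normr_gt0.
  pose F (z : R * R) := `|c (z.1 + z.2) - c z.1|.
  have cF : {for (u, w), continuous F}.
    apply: cvg_norm; apply: cvgB.
      apply: (@continuous_comp _ _ _ (fun z : R * R => z.1 + z.2) c).
        by apply: cvgD; [exact: cvg_fst|exact: cvg_snd].
      exact: C1_continuous.
    apply: (@continuous_comp _ _ _ fst c); first exact: cvg_fst.
    exact: C1_continuous.
  have n1 : \forall z \near (u, w), e / 2 <= F z.
    have /cvgrPdist_le/(_ (e / 2)) := cF; rewrite divr_gt0// => /(_ isT).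
    apply: filterS => z /=; rewrite {1}/F /= -/e ler_norml => /andP[_ ?]; lra.
  have n2 : \forall z \near (u, w), `|z.2| <= 1.
    have : {for (u, w), continuous (fun z : R * R => `|z.2|)}.
      by apply: cvg_norm; exact: cvg_snd.
    move=> /cvgrPdist_le/(_ (2^-1)); rewrite invr_gt0 ltr0n => /(_ isT).
    by apply: filterS => z /=; rewrite ler_norml => /andP[? _]; lra.
  exists ([set z | e / 2 <= F z /\ `|z.2| <= 1], [set m | 0 < m <= e / 2]).
    split; first by apply: filterI.
    near=> m; apply/andP; split; near: m; first exact: nbhs_right_gt.
    by apply: nbhs_right_le; rewrite divr_gt0.
  move=> [z m] /= [[h1 h2] /andP[m0 m1]]; rewrite /P; apply: le_trans h1.
  by apply: le_trans m1; rewrite ler_piMr// ltW.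
have [m [m0 hm]] : exists m, 0 < m /\ K `<=` P m.
  near (0 : R)^'+ => m; exists m; split; near: m => //.
  exact: nbhs_right_gt.
exists m => // u w hw.
have := hm (u - (Num.floor u)%:~R, w); rewrite /K /P /= !in_itv/=.
have /andP[f0 f1] := floor_frac u.
rewrite f0 (ltW f1) -ler_norml hw => /(_ (conj isT isT)).
rewrite addrAC -!mulrNz !periodic1_int//.
Unshelve. all: by end_near. Qed.

End bilipschitz.

(* The library provides the complete and the normed structure of matrices but not
   their join. *)
HB.instance Definition _ (R : realType) (m n : nat) := Complete.on 'M[R]_(m, n).

(** The extension is the infimum of the cones d u + k |x - c u|, each of them k-Lipschitz in x. The
    hypothesis makes [d u] depend on [c u] only and places every cone above the prescribed
    values. *)
Lemma mcshane_extension (R : realType) (X : normedModType R) (T : Type) (u0 : T)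
    (c : T -> X) (d : T -> R) (k : R) :
  0 <= k -> (forall u v, `|d u - d v| <= k * `|c u - c v|) ->
  exists2 g : X -> R, (forall u, g (c u) = d u) &
    forall x y, `|g x - g y| <= k * `|x - y|.
Proof.
move=> k0 dc; pose A x := range (fun u => d u + k * `|x - c u|).
have lbA x : has_lbound (A x).
  exists (d u0 - k * `|x - c u0|) => _ [u _ <-].
  have h1 := dc u0 u.
  have h2 : `|c u0 - c u| <= `|x - c u0| + `|x - c u|.
    by rewrite (distrC x (c u0)); exact: ler_distD.
  have h3 := ler_wpM2l k0 h2; rewrite mulrDr in h3.
  have := ler_norm (d u0 - d u); lra.
have neA x : A x !=set0 by exists (d u0 + k * `|x - c u0|); exists u0.
have gle x u : inf (A x) <= d u + k * `|x - c u|.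
  by apply: ge_inf => //; exists u.
exists (fun x => inf (A x)).
  move=> u; apply/eqP; rewrite eq_le; apply/andP; split.
    by have := gle (c u) u; rewrite subrr normr0 mulr0 addr0.
  apply: lb_le_inf => // _ [v _ <-].
  have := dc u v; have := ler_norm (d u - d v); lra.
have one x y : inf (A x) - inf (A y) <= k * `|x - y|.
  rewrite lerBlDl -lerBlDr; apply: lb_le_inf => // _ [u _ <-].
  have := gle x u.
  have h3 := ler_wpM2l k0 (ler_distD y x (c u)); rewrite mulrDr in h3; lra.
move=> x y; rewrite ler_norml one andbT.
by have := one y x; rewrite distrC; lra.
Qed.

Section clamp.
Context {R : realType}.

(** Extends the isotopy to all real times, so that its estimates and its continuity hold without
    restricting t to [0, 1]. *)
Definition clamp01 (t : R) : R := Num.max 0 (Num.min t 1).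

Lemma clamp01_bound t : 0 <= clamp01 t <= 1.
Proof. by rewrite /clamp01 le_max lexx /= ge_max ler01 /= ge_min lexx orbT. Qed.

Lemma clamp01_id t : 0 <= t <= 1 -> clamp01 t = t.
Proof. by move=> /andP[t0 t1]; rewrite /clamp01 min_l// max_r. Qed.

Lemma continuous_clamp01 : continuous clamp01.
Proof.
move=> t; apply: (@continuous_max R R (cst 0) (id \min cst 1)).
  exact: cvg_cst.
by apply: continuous_min; [exact: cvg_id|exact: cvg_cst].
Qed.
End clamp.

Section small_isotopy.
Context {R : realType} {n : nat}.
Variable V : 'rV[R]_n -> 'rV[R]_n.
Hypothesis lipV : forall x y, `|V x - V y| <= 2^-1 * `|x - y|.

Let Phi (t : R) x := x + clamp01 t *: V x.

Let lipZ t x y : `|clamp01 t *: V x - clamp01 t *: V y| <= 2^-1 * `|x - y|.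
Proof.
have /andP[a0 a1] := clamp01_bound t.
rewrite -scalerBr normrZ (ger0_norm a0).
by apply: le_trans (lipV x y); rewrite ler_piMl.
Qed.

(** A preimage of y is a fixed point of x |-> y - t V x (t clamped), a contraction of constant
    1/2. *)
Let Phi_surj t y : exists x, Phi t x = y.
Proof.
pose f x := y - clamp01 t *: V x.
have half0 : 0 <= 2^-1 :> R by rewrite invr_ge0.
have ctr : is_contraction
    ('totalfun_[set: 'rV[R]_n] f : {fun [set: 'rV[R]_n] >-> [set: 'rV[R]_n]}).
  exists (NngNum half0); split; first by rewrite /=; lra.
  move=> [x z] _ /=; rewrite /totalfun_ /f.
  have -> : y - clamp01 t *: V x - (y - clamp01 t *: V z) =
      - (clamp01 t *: V x - clamp01 t *: V z) by apply/rowP => i; rewrite !mxE; ring.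
  by rewrite normrN; exact: lipZ.
have [x _ xE] := banach_fixed_point ctr closedT (ex_intro _ 0 I).
by exists x; rewrite /Phi {1}xE /totalfun_ /f subrK.
Qed.

Let Psi t y := projT1 (cid (Phi_surj t y)).

Let PhiK t y : Phi t (Psi t y) = y.
Proof. exact: (projT2 (cid (Phi_surj t y))). Qed.

(** With t = t' this is injectivity of each stage; with t and t' distinct it is the joint continuity
    of the inverse in time and space. The factor 2 is 1 / (1 - 1/2). *)
Let Phi_expand t t' x x' :
  `|x - x'| <= 2 * (`|Phi t x - Phi t' x'| + `|clamp01 t - clamp01 t'| * `|V x'|).
Proof.
have E : x - x' = (Phi t x - Phi t' x') - (clamp01 t *: V x - clamp01 t *: V x')
    - (clamp01 t - clamp01 t') *: V x'.
  by rewrite /Phi; apply/rowP => i; rewrite !mxE; ring.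
have := lipZ t x x'.
have := ler_normB ((Phi t x - Phi t' x') - (clamp01 t *: V x - clamp01 t *: V x'))
  ((clamp01 t - clamp01 t') *: V x').
have := ler_normB (Phi t x - Phi t' x') (clamp01 t *: V x - clamp01 t *: V x').
rewrite -E normrZ; lra.
Qed.

Let PsiK t x : Psi t (Phi t x) = x.
Proof.
apply/eqP; rewrite -subr_eq0 -normr_le0.
have := Phi_expand t t (Psi t (Phi t x)) x.
by rewrite PhiK !subrr !normr0 mul0r addr0 mulr0.
Qed.

Let continuous_V : continuous V.
Proof.
move=> x; apply/(@cvgrPdist_lt _ _ _ (nbhs x) (nbhs_filter x)) => e e0.
apply/nbhs_ballP; exists e => //= y.
rewrite -ball_normE /= => xy; apply: le_lt_trans (lipV _ _) _.
have := normr_ge0 (x - y); lra.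
Qed.

Lemma small_lipschitz_isotopy (c : R -> 'rV[R]_n) :
  ambient_isotopic c (fun u => c u + V (c u)).
Proof.
exists Phi, Psi; split.
- apply: continuous_subspaceT => z; apply: cvgD; first exact: cvg_snd.
  apply: cvgZ.
    by apply: (@continuous_comp _ _ _ fst clamp01); [exact: cvg_fst|exact: continuous_clamp01].
  by apply: (@continuous_comp _ _ _ snd V); [exact: cvg_snd|exact: continuous_V].
- apply: continuous_subspaceT => -[t y] /=; apply/cvgrPdist_lt => e e0.
  set x := Psi t y; pose k := `|V x| + 1.
  have k0 : 0 < k by rewrite ltr_wpDl.
  have n1 : \forall z \near (t, y), `|y - z.2| < e / 4.
    have : {for (t, y), continuous (snd : R * 'rV[R]_n -> 'rV[R]_n)} by exact: cvg_snd.
    by move=> /cvgrPdist_lt/(_ (e / 4)); rewrite divr_gt0// => /(_ isT).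
  have n2 : \forall z \near (t, y), `|clamp01 t - clamp01 z.1| < e / 4 / k.
    have : {for (t, y), continuous (fun z : R * 'rV[R]_n => clamp01 z.1)}.
      by apply: (@continuous_comp _ _ _ fst clamp01); [exact: cvg_fst|exact: continuous_clamp01].
    by move=> /cvgrPdist_lt/(_ (e / 4 / k)); rewrite !divr_gt0// => /(_ isT).
  near=> z; rewrite distrC.
  apply: le_lt_trans (Phi_expand z.1 t _ _) _; rewrite !PhiK -/x.
  have h1 : `|y - z.2| < e / 4 by near: z.
  have h2 : `|clamp01 t - clamp01 z.1| < e / 4 / k by near: z.
  rewrite (distrC z.2) (distrC (clamp01 z.1)).
  have h3 : `|clamp01 t - clamp01 z.1| * `|V x| <= e / 4.
    apply: (@le_trans _ _ (`|clamp01 t - clamp01 z.1| * k)).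
      by rewrite ler_wpM2l// lerDl.
    by rewrite -ler_pdivlMr// ltW.
  lra.
- by move=> t _; split => x; [exact: PsiK|exact: PhiK].
- by apply/funext => x; rewrite /Phi clamp01_id ?lexx ?ler01// scale0r addr0.
- by apply/funext => u /=; rewrite /Phi clamp01_id ?lexx ?ler01// scale1r.
Unshelve. all: by end_near. Qed.
End small_isotopy.

(** * Ambient isotopy is an equivalence relation *)

Section ambient_isotopy_equivalence.
Context {R : realType} {n : nat}.
Implicit Types (c : R -> 'rV[R]_n) (F G : R -> 'rV[R]_n -> 'rV[R]_n).

Let A : set (R * 'rV[R]_n) := `[0, 1] `*` setT.

Lemma continuous_levelwise_comp F G :
  {within A, continuous (fun z => F z.1 z.2)} ->
  {within A, continuous (fun z => G z.1 z.2)} ->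
  {within A, continuous (fun z => F z.1 (G z.1 z.2))}.
Proof.
move=> /subspace_continuousP cF /subspace_continuousP cG.
apply/subspace_continuousP => z Az.
pose h (z : R * 'rV[R]_n) := (z.1, G z.1 z.2).
have ch : h @ within A (nbhs z) --> h z.
  have c1 : fst @ within A (nbhs z) --> z.1.
    apply: cvg_trans (@cvg_fst _ _ (nbhs z.1) (nbhs z.2) _).
    by apply: cvg_app; exact: cvg_within.
  exact: (cvg_pair c1 (cG z Az)).
have Ah w : A w -> A (h w) by case.
move=> U /(cF (h z) (Ah _ Az)) h1.
have h2 : nbhs z [set w | A w -> A (h w) -> U (F (h w).1 (h w).2)] := ch _ h1.
change (nbhs z [set w | A w -> U (F w.1 (G w.1 w.2))]).
by apply: filterS h2 => w hw Aw; exact: hw Aw (Ah w Aw).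
Qed.

Lemma ambient_isotopic_refl c : ambient_isotopic c c.
Proof.
exists (fun _ => id), (fun _ => id); split => //.
- by apply: continuous_subspaceT => z; exact: cvg_snd.
- by apply: continuous_subspaceT => z; exact: cvg_snd.
Qed.

Lemma ambient_isotopic_sym c c' : ambient_isotopic c c' -> ambient_isotopic c' c.
Proof.
move=> [Phi [Psi [cPhi cPsi K P0 P1]]]; exists Psi, Phi; split => //.
- by move=> t t01; have [? ?] := K t t01.
- have [h _] := K 0 ltac:(by rewrite lexx ler01).
  by apply/funext => x; have := h x; rewrite P0.
- have [h _] := K 1 ltac:(by rewrite lexx ler01).
  by apply/funext => u; rewrite -P1 /= h.
Qed.

Lemma ambient_isotopic_trans c1 c2 c3 :
  ambient_isotopic c1 c2 -> ambient_isotopic c2 c3 -> ambient_isotopic c1 c3.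
Proof.
move=> [Phi [Psi [cPhi cPsi K P0 P1]]] [Phi' [Psi' [cPhi' cPsi' K' P0' P1']]].
exists (fun t x => Phi' t (Phi t x)), (fun t x => Psi t (Psi' t x)); split.
- exact: (@continuous_levelwise_comp Phi' Phi).
- exact: (@continuous_levelwise_comp Psi Psi').
- move=> t t01; have [h1 h2] := K t t01; have [h1' h2'] := K' t t01.
  by split => x; rewrite ?h1' ?h2 ?h1 ?h2'.
- by rewrite P0 P0'.
- by apply/funext => u; rewrite -P1' -P1.
Qed.

Lemma knot_class_isotopic c c' : ambient_isotopic c c' -> knot_class c' = knot_class c.
Proof.
move=> cc'; apply/seteqP; split => x [ex hx]; split => //.
  exact: ambient_isotopic_trans cc' hx.
exact: ambient_isotopic_trans (ambient_isotopic_sym cc') hx.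
Qed.

End ambient_isotopy_equivalence.

(** * Isotopy of C^1-close curves, and a connectedness argument *)

Section close_curves.
Context {R : realType} {n : nat}.

(** Each coordinate of c1 - c changes by at most (m / 2) |w| over an increment w, while [c] moves by
    at least m |w|: the ratio is the constant 1/2 of the small isotopy. *)
Lemma ambient_isotopic_C1_close (c c1 : R -> 'rV[R]_n) (m : R) :
  C1 c -> periodic1 c -> C1 c1 -> periodic1 c1 ->
  (forall u w, `|w| <= 2^-1 -> m * `|w| <= `|c (u + w) - c u|) ->
  (forall u, `|derive1 c1 u - derive1 c u| <= m / 2) ->
  ambient_isotopic c c1.
Proof.
move=> cc pc cc1 pc1 hm hd.
pose d i u := c1 u 0 i - c u 0 i.
have pd i : periodic1 (d i) by move=> u; rewrite /d pc pc1.
have dl i u w : `|w| <= 2^-1 -> `|d i (u + w) - d i u| <= 2^-1 * `|c (u + w) - c u|.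
  move=> hw; have dd x : is_derive x (1 : R) (d i) (derive1 c1 x 0 i - derive1 c x 0 i).
    have h1 := is_derive_coord i cc x; have h2 := is_derive_coord i cc1 x.
    exact: is_deriveB.
  have bd x : `|derive1 c1 x 0 i - derive1 c x 0 i| <= m / 2.
    apply: le_trans (hd x).
    by have := ler_coord_norm (derive1 c1 x - derive1 c x) i; rewrite !mxE.
  have := derive_bounded_lipschitz dd bd u (u + w).
  rewrite [u + w - u]addrAC subrr add0r; have := hm u w hw; lra.
have dL i u v : `|d i u - d i v| <= 2^-1 * `|c u - c v|.
  (* [k] is an integer nearest to u - v; by periodicity only the remainder [w] matters. *)
  pose k := Num.floor (u - v + 2^-1); pose w := u - v - k%:~R.
  have hw : `|w| <= 2^-1.
    have := floor_frac (u - v + 2^-1); rewrite -/k /w ler_norml => /andP[? ?].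
    by apply/andP; split; lra.
  have uE : u = v + w + k%:~R by rewrite /w; ring.
  by rewrite uE !periodic1_int//; exact: dl.
have half0 : 0 <= 2^-1 :> R by rewrite invr_ge0.
have /choice [g hg] i : exists g : 'rV[R]_n -> R, (forall u, g (c u) = d i u) /\
    forall x y, `|g x - g y| <= 2^-1 * `|x - y|.
  by have [g h1 h2] := mcshane_extension 0 half0 (dL i); exists g.
pose V x : 'rV[R]_n := \row_i g i x.
have lipV x y : `|V x - V y| <= 2^-1 * `|x - y|.
  apply: norm_le_coord => [|i]; first by rewrite mulr_ge0.
  by rewrite !mxE; exact: (hg i).2.
rewrite (_ : c1 = fun u => c u + V (c u)); first exact: small_lipschitz_isotopy.
apply/funext => u; apply/rowP => i; rewrite !mxE (hg i).1 /d; ring.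
Qed.

(** The local equivalence makes both Q and its negation relatively open, so the set where Q holds is
    open and closed in the connected segment. *)
Lemma locally_constant_segment (T : R) (Q : R -> Prop) : 0 <= T ->
  (forall t, 0 <= t <= T -> exists2 d, 0 < d &
    forall x, 0 <= x <= T -> `|x - t| < d -> (Q t <-> Q x)) ->
  Q 0 -> Q T.
Proof.
move=> T0 lc Q0; pose S : set R := `[0, T].
have SE x : S x <-> 0 <= x <= T by rewrite /S /= in_itv.
have cS : connected S by exact: segment_connected.
have nb (P : R -> Prop) t : S t -> (forall x, S x -> (Q t <-> Q x) -> P x) ->
    interior [set x | S x -> P x] t.
  move=> /SE /lc [d d0 hd] hP; apply/nbhs_ballP; exists d => // x.
  rewrite /ball /= distrC => xd Sx; apply: hP => //; apply: hd xd.
  by move/SE: Sx.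
have S0 : S 0 by apply/SE; rewrite lexx.
have : S `&` [set x | Q x] = S.
  apply: cS.
  - by exists 0.
  - exists (interior [set x | S x -> Q x]); first exact: open_interior.
    apply/seteqP; split => x [Sx Qx]; split => //.
      by apply: nb => // y _ [+ _]; exact.
    by have := interior_subset Qx; exact.
  - exists (~` interior [set x | S x -> ~ Q x]).
      by apply: open_closedC; exact: open_interior.
    apply/seteqP; split => x [Sx Qx]; split => //.
      by move=> /interior_subset /(_ Sx).
    apply: contrapT => nQ; apply: Qx; apply: nb => // y _ [_ h] Qy.
    exact: nQ (h Qy).
by move=> /seteqP[_ /(_ T)] []//; apply/SE; rewrite T0 lexx.
Qed.

End close_curves.

(** * Embeddedness and knot class along the flow *)

Section flow_isotopy.
Context {R : realType} {n : nat} {p : R}.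
Hypothesis hp : 7 / 3 < p < 8 / 3.
Variables (g0 : menger_space n p) (g : R -> menger_space n p).
Hypotheses (g0_emb : embedded g0) (g0_reg : regular g0).
Hypothesis g_flow : is_projected_flow g0 g.

Lemma flow_embedded t : 0 <= t -> embedded (g t).
Proof.
move=> t0; have [_ g00 fg] := g_flow.
(* The flow equation, and with it a gradient, is given for positive times only; at time 0
   embeddedness is the assumption on [g0]. *)
have [->|tn0] := eqVneq t 0; first by rewrite g00.
have [|v [gr [fin _ _] _] _] := fg t; first by rewrite lt_def tn0.
exact: embedded_of_finite_energy_near (flow_regular hp g_flow g0_reg t0) fin.
Qed.

Lemma flow_isotopic t : 0 <= t -> ambient_isotopic g0 (g t).
Proof.
move=> t0; have [C1g g00 _] := g_flow.
apply: (@locally_constant_segment _ t (fun x => ambient_isotopic g0 (g x))) => //; last first.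
  by rewrite g00; exact: ambient_isotopic_refl.
move=> x /andP[x0 _].
have [cc _] := curveP (g x); have pc := curve_periodic (g x).
have [m m0 hm] := embedded_bilipschitz cc pc (flow_regular hp g_flow g0_reg x0)
  (flow_embedded x0).
have [K K0 hK] := @menger_derive1_le R n p hp.
have [d d0 [L L0 hL]] := C1_halfline_lipschitz C1g x0.
(* Within this radius the derivatives of [g x] and [g y] differ by at most K L |y - x| <= m / 2. The
   radius depends on x through [m], [d] and [L], which the connectedness argument allows. *)
exists (Num.min d (m / 2 / (K * L))); first by rewrite lt_min d0 !divr_gt0// mulr_gt0.
move=> y /andP[y0 _]; rewrite lt_min => /andP[yd ym].
have iso : ambient_isotopic (g x) (g y).
  have [cy _] := curveP (g y).
  apply: (ambient_isotopic_C1_close cc pc cy (curve_periodic (g y)) hm) => u.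
  have <- : derive1 (g y - g x) u = derive1 (g y) u - derive1 (g x) u.
    apply/rowP => i; rewrite !mxE.
    exact: (linear_formB (fun a f h => derive1_curve_lin a f h u i)).1.
  apply: le_trans (hK _ _) _.
  apply: (@le_trans _ _ (K * (L * `|y - x|))).
    by rewrite ler_pM2l//; exact: hL.
  by rewrite mulrA mulrC -ler_pdivlMr ?mulr_gt0// ltW.
split => h; first exact: ambient_isotopic_trans h iso.
exact: ambient_isotopic_trans h (ambient_isotopic_sym iso).
Qed.
End flow_isotopy.

Theorem corollary1p2 (R : realType) (n : nat) (p : R)
    (hp : 7 / 3 < p < 8 / 3)
    (gamma0 : menger_space n p)
    (gamma0_emb : embedded gamma0) (gamma0_reg : regular gamma0)
    (gamma : R -> menger_space n p)
    (gamma_flow : is_projected_flow gamma0 gamma) :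
  (forall t, 0 <= t -> embedded (gamma t)) /\
  (forall K : set (R -> 'rV[R]_n), tame_knot_class K ->
     knot_class gamma0 = K ->
     forall t, 0 < t -> knot_class (gamma t) = K).
Proof.
split=> [t|K _ <- t t0]; first exact: (flow_embedded hp gamma0_emb gamma0_reg gamma_flow).
apply: knot_class_isotopic.
by apply: (flow_isotopic hp gamma0_emb gamma0_reg gamma_flow); exact: ltW.
Qed.
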